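(* Let $F$ be a field. There is an isomorphism of abelian groups $$\big(\mathrm{St}_2(F)\otimes \mathrm{St}_2(F)\big)_{\mathrm{SL}_2(F)} \;\cong\; \mathrm{GW}(F),$$ where the left-hand side denotes the coinvariants for the diagonal $\mathrm{SL}_2(F)$-action on the double Steinberg module and $\mathrm{GW}(F)$ is the (symmetric) Grothendieck--Witt group of $F$.
   Context: For $n\ge 1$, the Steinberg module $\mathrm{St}_n(F)$ is the top reduced homology of the Tits building of $F^n$; it is given by the following presentation: it is the quotient of the free abelian group on symbols $[A]$, $A\in \mathrm{GL}_n(F)$, where we write $[A]=[v_1,\dots,v_n]$ if the $i$th column of $A$ is $v_i$, by the relations (a) $[v_1,\dots,v_n]=[v_1,\dots,v_i+\lambda v_j,\dots,v_j,\dots,v_n]+[v_1,\dots,v_i,\dots,v_i+\lambda v_j,\dots,v_n]$ for $\lambda\in F^\times$, $1\le i<j\le n$ (in the first summand the $i$th column is replaced by $v_i+\lambda v_j$, in the second summand the $j$th column is); (b) $[v_1,\dots,v_n]=[v_1,\dots,\lambda v_i,\dots,v_n]$ for $\lambda\in F^\times$, $1\le i\le n$; (c) $[v_1,\dots,v_n]=(-1)^\sigma[v_{\sigma(1)},\dots,v_{\sigma(n)}]$ for $\sigma\in\mathfrak S_n$, where $(-1)^\sigma$ is the sign of $\sigma$. The group $\mathrm{GL}_n(F)$ acts on $\mathrm{St}_n(F)$ by $M\cdot[A]=[MA]$ and diagonally on $\mathrm{St}_n(F)\otimes\mathrm{St}_n(F)$ (tensor product over $\mathbb Z$). $\mathrm{GW}(F)$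 is the group completion of the abelian monoid, under orthogonal sum, of isomorphism classes of nondegenerate symmetric bilinear forms on finite-dimensional $F$-vector spaces. *)

(* Defs.v *)
From HB Require Import structures.
From mathcomp Require Import all_boot all_order all_algebra perm sesquilinear.
From mathcomp Require Import boolp.
From mathcomp.multinomials Require Import freeg.

Set Implicit Arguments.
Unset Strict Implicit.
Unset Printing Implicit Defensive.

Import GRing.Theory VectorInternalTheory.
Local Open Scope ring_scope.
Local Open Scope quotient_scope.

Section Quotient.
Variables (V : zmodType) (S : V -> Prop).

(* Membership in the subgroup generated by S. *)
Inductive zgen : V -> Prop :=
| zgen_rel x : S x -> zgen x
| zgen0 : zgen 0
| zgenB x y : zgen x -> zgen y -> zgen (x - y).

Definition zgen_pred : {pred V} := fun x => `[< zgen x >].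

Lemma zgen_closed : zmod_closed zgen_pred.
Proof.
split=> [|x y /asboolP hx /asboolP hy]; apply/asboolP; first exact: zgen0.
exact: zgenB.
Qed.

HB.instance Definition _ := GRing.isZmodClosed.Build V zgen_pred zgen_closed.

Definition zquot : zmodType := Quotient.quot zgen_pred.

Definition zproj : {additive V -> zquot} :=
  \pi_(Quotient.quot zgen_pred) : {additive _ -> _}.

Definition zrepr (x : zquot) : V := repr (x : Quotient.quot zgen_pred).

Lemma zreprK x : zproj (zrepr x) = x.
Proof. exact: reprK. Qed.

Lemma zproj_eq x y : zgen (x - y) -> zproj x = zproj y.
Proof. by move=> h; apply/eqP; rewrite piE; apply/asboolP. Qed.

Lemma zproj0 x : S x -> zproj x = 0.
Proof.
move=> Sx; rewrite -(raddf0 zproj); apply: zproj_eq; rewrite subr0.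
exact: zgen_rel.
Qed.

Lemma zproj_inj x y : zproj x = zproj y -> zgen (x - y).
Proof. by move/eqP; rewrite piE => /asboolP. Qed.

Section Lift.
Variables (W : zmodType) (f : V -> W).
Hypotheses (fB : zmod_morphism f) (fS : forall x, S x -> f x = 0).

Lemma zlift_proj x : f (zrepr (zproj x)) = f x.
Proof.
have f0 y : zgen y -> f y = 0.
  elim=> [z /fS||z t _ hz _ ht] //; first by rewrite -(subrr 0) fB subrr.
  by rewrite fB hz ht subrr.
by apply/eqP; rewrite -subr_eq0 -fB f0 //; apply: zproj_inj; rewrite zreprK.
Qed.

Lemma zlift_zmod_morphism : zmod_morphism (f \o zrepr).
Proof.
move=> x y; rewrite -(zreprK x) -(zreprK y) -(raddfB zproj) /= !zlift_proj.
exact: fB.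
Qed.
End Lift.
End Quotient.

Section FreeAb.
Variable T : choiceType.

Definition freeab : zmodType := {freeg T / int}.

Definition fgen (x : T) : freeab := << x >>.

Variables (W : zmodType) (f : T -> W).

(* zmodule W is W with its canonical int-module structure. *)
Definition freeab_lift (D : freeab) : W := fglift (f : T -> zmodule W) D.

Lemma freeab_lift_zmod_morphism : zmod_morphism freeab_lift.
Proof. exact: (lift_is_additive (f : T -> zmodule W)). Qed.

HB.instance Definition _ :=
  GRing.isZmodMorphism.Build freeab W freeab_lift freeab_lift_zmod_morphism.

Lemma freeab_liftB x y : freeab_lift (x - y) = freeab_lift x - freeab_lift y.
Proof. exact: raddfB. Qed.

Lemma freeab_liftD x y : freeab_lift (x + y) = freeab_lift x + freeab_lift y.
Proof. exact: raddfD. Qed.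

Lemma freeab_liftMz x m : freeab_lift (x *~ m) = freeab_lift x *~ m.
Proof. exact: raddfMz. Qed.

Lemma freeab_liftE x : freeab_lift (fgen x) = f x.
Proof. by rewrite /freeab_lift /fgen liftU scale1r. Qed.
End FreeAb.

Section Tensor.
Variables A B : zmodType.

Inductive tensor_rel : freeab (A * B)%type -> Prop :=
| tensor_relDl a a' b :
    tensor_rel (fgen (a + a', b) - (fgen (a, b) + fgen (a', b)))
| tensor_relDr a b b' :
    tensor_rel (fgen (a, b + b') - (fgen (a, b) + fgen (a, b'))).

Definition tensor : zmodType := zquot tensor_rel.

Definition tens (a : A) (b : B) : tensor := zproj tensor_rel (fgen (a, b)).

Lemma tensDl a a' b : tens (a + a') b = tens a b + tens a' b.
Proof.
rewrite /tens -(raddfD (zproj tensor_rel)); apply/zproj_eq/zgen_rel.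
exact: tensor_relDl.
Qed.

Lemma tensDr a b b' : tens a (b + b') = tens a b + tens a b'.
Proof.
rewrite /tens -(raddfD (zproj tensor_rel)); apply/zproj_eq/zgen_rel.
exact: tensor_relDr.
Qed.
End Tensor.

Section TensorMap.
Variables (A B A' B' : zmodType).
Variables (f : {additive A -> A'}) (g : {additive B -> B'}).

Local Notation F := (freeab_lift (fun p : (A * B)%type => tens (f p.1) (g p.2))).

Definition tensor_map (x : tensor A B) : tensor A' B' := F (zrepr x).

Lemma tensor_map_rel x : tensor_rel x -> F x = 0.
Proof.
by case=> [a a' b|a b b']; rewrite freeab_liftB freeab_liftD !freeab_liftE
  [in LHS]/= raddfD (tensDl, tensDr) subrr.
Qed.

Lemma tensor_mapE a b : tensor_map (tens a b) = tens (f a) (g b).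
Proof.
rewrite /tensor_map (zlift_proj (freeab_lift_zmod_morphism _) tensor_map_rel).
exact: freeab_liftE.
Qed.

HB.instance Definition _ := GRing.isZmodMorphism.Build _ _ tensor_map
  (zlift_zmod_morphism (freeab_lift_zmod_morphism _) tensor_map_rel).
End TensorMap.

Definition coinvariants (G : Type) (V : zmodType) (act : G -> V -> V) : zmodType :=
  zquot (fun x => exists (g : G) (v : V), x = act g v - v).

Section GroupCompletion.
Variable M : nmodType.

Inductive completion_rel : freeab M -> Prop :=
| completion_relD x y : completion_rel (fgen (x + y) - (fgen x + fgen y)).

Definition group_completion : zmodType := zquot completion_rel.
End GroupCompletion.

Section Steinberg.
Variables (F : fieldType) (n : nat).

Record GL := MkGL { GLval :> 'M[F]_n; GLvalP : GLval \in unitmx }.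
HB.instance Definition _ := [isSub for GLval].
HB.instance Definition _ := [Choice of GL by <:].

Definition GLmul (M A : GL) : GL :=
  MkGL (etrans (unitmx_mul M A) (introT andP (conj (GLvalP M) (GLvalP A)))).

Definition SL := {M : GL | \det M == 1}.

Definition set_col (A : 'M[F]_n) (i : 'I_n) (v : 'cV[F]_n) : 'M[F]_n :=
  \matrix_(r, k) if k == i then v r 0 else A r k.

(* The matrices B, C below are automatically invertible; they are quantified
   over GL only so as to be generators of the free group. *)
Inductive Steinberg_rel : freeab GL -> Prop :=
| Steinberg_rel_add (A B C : GL) (i j : 'I_n) (l : F) :
    l != 0 -> (i < j)%N ->
    B = set_col A i (col i A + l *: col j A) :> 'M_n ->
    C = set_col A j (col i A + l *: col j A) :> 'M_n ->
    Steinberg_rel (fgen A - (fgen B + fgen C))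
| Steinberg_rel_scale (A B : GL) (i : 'I_n) (l : F) :
    l != 0 ->
    B = set_col A i (l *: col i A) :> 'M_n ->
    Steinberg_rel (fgen A - fgen B)
| Steinberg_rel_perm (A B : GL) (s : 'S_n) :
    B = col_perm s A :> 'M_n ->
    Steinberg_rel (fgen A - fgen B *~ (-1) ^+ s).

Definition Steinberg : zmodType := zquot Steinberg_rel.

Definition Steinberg_sym (A : GL) : Steinberg := zproj Steinberg_rel (fgen A).

Section Action.
Variable M : GL.

Local Notation act := (freeab_lift (fun A => Steinberg_sym (GLmul M A))).

Definition Steinberg_act (x : Steinberg) : Steinberg := act (zrepr x).

Lemma mul_set_col (A : 'M[F]_n) i v :
  M *m set_col A i v = set_col (M *m A) i (M *m v).
Proof.
apply/matrixP=> r k; rewrite [LHS]mxE [RHS]mxE; case: ifP => ki; rewrite mxE;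
  by apply: eq_bigr => q _; rewrite mxE ki.
Qed.

Lemma Steinberg_act_rel x : Steinberg_rel x -> act x = 0.
Proof.
have colM (A : 'M[F]_n) i : M *m col i A = col i (M *m A) by rewrite colE colE mulmxA.
case=> [A B C i j l l0 ij hB hC|A B i l l0 hB|A B s hB].
- rewrite freeab_liftB freeab_liftD !freeab_liftE.
  rewrite -(raddfD (zproj _)) -(raddfB (zproj _)); apply: zproj0.
  by apply: (@Steinberg_rel_add _ _ _ i j l) => //=;
    rewrite ?hB ?hC mul_set_col mulmxDr -scalemxAr !colM.
- rewrite freeab_liftB !freeab_liftE -(raddfB (zproj _)); apply: zproj0.
  apply: (@Steinberg_rel_scale _ _ i l) => //=.
  by rewrite hB mul_set_col -scalemxAr colM.
- rewrite freeab_liftB freeab_liftMz !freeab_liftE.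
  rewrite -(raddfMz (zproj _)) -(raddfB (zproj _)); apply: zproj0.
  by apply: Steinberg_rel_perm; rewrite /= hB !col_permE mulmxA.
Qed.

Lemma Steinberg_actE A :
  Steinberg_act (Steinberg_sym A) = Steinberg_sym (GLmul M A).
Proof.
rewrite /Steinberg_act.
rewrite (zlift_proj (freeab_lift_zmod_morphism _) Steinberg_act_rel).
exact: freeab_liftE.
Qed.

HB.instance Definition _ := GRing.isZmodMorphism.Build _ _ Steinberg_act
  (zlift_zmod_morphism (freeab_lift_zmod_morphism _) Steinberg_act_rel).
End Action.

Definition Steinberg2_act (M : GL) :
    tensor Steinberg Steinberg -> tensor Steinberg Steinberg :=
  tensor_map (Steinberg_act M) (Steinberg_act M).
End Steinberg.

Section Nondegenerate.
Variables (F : fieldType) (V : vectType F) (b : {symmetric V}).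

Lemma nondegenerateP :
  reflect (forall u, (forall v, b u v = 0) -> u = 0) (nondegenerate b).
Proof.
rewrite /nondegenerate -subv0; apply: (iffP subvP) => h u.
  by move=> bu; apply/eqP; rewrite -memv0 h //; apply/mem_orthovP => v _.
move/mem_orthovP => bu; rewrite memv0; apply/eqP/h => v.
by rewrite bu ?memvf.
Qed.
End Nondegenerate.

Section OrthSum.
Variables (F : fieldType) (V W : vectType F).
Variables (b : {symmetric V}) (c : {symmetric W}).

Definition orth_form (u v : V * W) : F := b u.1 v.1 + c u.2 v.2.

Lemma orth_form_bilinear :
  bilinear_for (GRing.Scale.Law.clone F F *%R _)
    (GRing.Scale.Law.clone F F (idfun \; *%R) _) orth_form.
Proof.
split=> [w k u v|w k u v]; rewrite /orth_form /=.
  by rewrite !linearPl /= mulrDr addrACA.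
by rewrite !linearPr /= mulrDr addrACA.
Qed.

HB.instance Definition _ :=
  bilinear_isBilinear.Build F _ _ _ _ _ orth_form orth_form_bilinear.

Lemma orth_form_sym u v :
  orth_form u v = (-1) ^+ false * idfun (orth_form v u).
Proof. by rewrite expr0 mul1r /orth_form /= hermC [c _ _]hermC !mul1r. Qed.

HB.instance Definition _ :=
  isHermitianSesquilinear.Build F _ false idfun orth_form orth_form_sym.

Lemma orth_form_nondegenerate :
  nondegenerate b -> nondegenerate c -> nondegenerate orth_form.
Proof.
move=> /nondegenerateP hb /nondegenerateP hc.
apply/nondegenerateP => -[u w] h; congr (_, _).
  by apply: hb => v; move: (h (v, 0)); rewrite /= /orth_form /= linear0r addr0.
by apply: hc => v; move: (h (0, v)); rewrite /= /orth_form /= linear0r add0r.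
Qed.
End OrthSum.

Section GrothendieckWitt.
Variable F : fieldType.

Record symForm := SymForm {
  sf_space : vectType F;
  sf_form : {symmetric sf_space};
  sf_nondeg : nondegenerate sf_form
}.

Definition sf_isometric (b c : symForm) : Prop :=
  exists f : {linear sf_space b -> sf_space c},
    bijective f /\ isometry (sf_form c) (sf_form b) f.

Definition sf_orth (b c : symForm) : symForm :=
  SymForm (orth_form_nondegenerate (sf_nondeg b) (sf_nondeg c)).

Lemma sf_isometricI (b c : symForm) (f : sf_space b -> sf_space c) :
  linear f -> bijective f -> isometry (sf_form c) (sf_form b) f ->
  sf_isometric b c.
Proof.
move=> fL fbij fiso.
by exists (HB.pack_for {linear sf_space b -> sf_space c} f
  (GRing.isLinear.Build _ _ _ _ f fL)).
Qed.

Lemma sf_isometric_refl b : sf_isometric b b.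
Proof. by apply: (@sf_isometricI _ _ idfun) => //; exists idfun. Qed.

Lemma sf_isometric_sym b c : sf_isometric b c -> sf_isometric c b.
Proof.
case=> f [[g fK gK] fiso]; apply: (@sf_isometricI _ _ g); last 2 first.
- by exists f.
- by move=> u v; rewrite -fiso !gK.
by move=> k u v; apply: (can_inj fK); rewrite linearP !gK.
Qed.

Lemma sf_isometric_trans b c d :
  sf_isometric b c -> sf_isometric c d -> sf_isometric b d.
Proof.
case=> f [fbij fiso] [g [gbij giso]]; apply: (@sf_isometricI _ _ (g \o f)).
- by move=> k u v; rewrite /= !linearP.
- exact: bij_comp.
- by move=> u v; rewrite /= giso fiso.
Qed.

Lemma sf_orth_isometric b b' c c' :
  sf_isometric b b' -> sf_isometric c c' ->
  sf_isometric (sf_orth b c) (sf_orth b' c').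
Proof.
case=> f [[f' fK f'K] fiso] [g [[g' gK g'K] giso]].
apply: (@sf_isometricI (sf_orth b c) (sf_orth b' c') (fun p => (f p.1, g p.2))).
- by move=> k u v; rewrite /= !linearP.
- exists (fun p => (f' p.1, g' p.2)) => -[u v] /=; first by rewrite fK gK.
  by rewrite f'K g'K.
- by move=> u v; rewrite /= /orth_form /= fiso giso.
Qed.

Lemma sf_orthC b c : sf_isometric (sf_orth b c) (sf_orth c b).
Proof.
apply: (@sf_isometricI (sf_orth b c) (sf_orth c b) (fun p => (p.2, p.1))) => //.
- by exists (fun p => (p.2, p.1)) => -[].
- by move=> u v; rewrite /= /orth_form addrC.
Qed.

Lemma sf_orthA b c d :
  sf_isometric (sf_orth b (sf_orth c d)) (sf_orth (sf_orth b c) d).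
Proof.
apply: (@sf_isometricI (sf_orth b (sf_orth c d)) (sf_orth (sf_orth b c) d)
  (fun p => ((p.1, p.2.1), p.2.2))) => //.
- by exists (fun p => (p.1.1, (p.1.2, p.2))) => [[u [v w]]|[[u v] w]].
- by move=> u v; rewrite /= /orth_form /= /orth_form /= addrA.
Qed.

Definition zero_form (u v : 'rV[F]_0) : F := 0.

Lemma zero_form_bilinear :
  bilinear_for (GRing.Scale.Law.clone F F *%R _)
    (GRing.Scale.Law.clone F F (idfun \; *%R) _) zero_form.
Proof. by split=> [w k u v|w k u v]; rewrite /zero_form /= mulr0 addr0. Qed.

HB.instance Definition _ :=
  bilinear_isBilinear.Build F _ _ _ _ _ zero_form zero_form_bilinear.

Lemma zero_form_sym u v :
  zero_form u v = (-1) ^+ false * idfun (zero_form v u).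
Proof. by rewrite expr0 mul1r. Qed.

HB.instance Definition _ :=
  isHermitianSesquilinear.Build F _ false idfun zero_form zero_form_sym.

Lemma zero_form_nondegenerate : nondegenerate zero_form.
Proof. by apply/nondegenerateP => u _; rewrite thinmx0. Qed.

Definition sf_zero : symForm := SymForm zero_form_nondegenerate.

Lemma sf_orth0 b : sf_isometric (sf_orth sf_zero b) b.
Proof.
apply: (@sf_isometricI (sf_orth sf_zero b) b snd) => //.
- by exists (fun u => (0, u)) => [[z u]|//]; rewrite [z]thinmx0.
- by move=> u v; rewrite /= /orth_form /= add0r.
Qed.

(* Forms on all finite-dimensional spaces do not form a small type; the set of
   their isomorphism classes is cut out of the forms on the spaces F^n, which
   represent every class (coord_form_isometric). *)
Record coordForm := CoordForm {
  cf_dim : nat;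
  cf_form : {symmetric 'rV[F]_cf_dim};
  cf_nondeg : nondegenerate cf_form
}.

Definition sf_of_coord (b : coordForm) : symForm := SymForm (cf_nondeg b).

Section Coord.
Variable b : symForm.
Local Notation V := (sf_space b).

Definition coord_form (u v : 'rV[F]_(dim V)) : F := sf_form b (r2v u) (r2v v).

Lemma coord_form_bilinear :
  bilinear_for (GRing.Scale.Law.clone F F *%R _)
    (GRing.Scale.Law.clone F F (idfun \; *%R) _) coord_form.
Proof.
split=> [w k u v|w k u v]; rewrite /coord_form /= linearP.
  by rewrite linearPl.
by rewrite linearPr.
Qed.

HB.instance Definition _ :=
  bilinear_isBilinear.Build F _ _ _ _ _ coord_form coord_form_bilinear.

Lemma coord_form_sym u v :
  coord_form u v = (-1) ^+ false * idfun (coord_form v u).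
Proof. by rewrite /coord_form hermC. Qed.

HB.instance Definition _ :=
  isHermitianSesquilinear.Build F _ false idfun coord_form coord_form_sym.

Lemma coord_form_nondegenerate : nondegenerate coord_form.
Proof.
have /nondegenerateP hb := sf_nondeg b.
apply/nondegenerateP => u h; apply: (can_inj r2vK); rewrite linear0.
by apply: hb => v; rewrite -(v2rK v); exact: h.
Qed.

Definition coord_of_sf : coordForm := CoordForm coord_form_nondegenerate.

Lemma coord_form_isometric : sf_isometric b (sf_of_coord coord_of_sf).
Proof.
apply: (@sf_isometricI b (sf_of_coord coord_of_sf) v2r).
- exact: linearP.
- exact: (Bijective (@v2rK F V) (@r2vK F V)).
- by move=> u v; rewrite /= /coord_form !v2rK.
Qed.
End Coord.

(* {classic coordForm} adds the choice structure that quotients require. *)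
Definition sf_rel (b c : {classic coordForm}) : bool :=
  `[< sf_isometric (sf_of_coord b) (sf_of_coord c) >].

Lemma sf_rel_equiv : equiv_class_of sf_rel.
Proof.
split=> [b|b c|c b d].
- exact/asboolP/sf_isometric_refl.
- by apply/asboolP/asboolP => /sf_isometric_sym.
- by move=> /asboolP bc /asboolP cd; apply/asboolP/(sf_isometric_trans bc).
Qed.

Canonical sf_rel_equivRel := EquivRelPack sf_rel_equiv.

Definition sf_class := {eq_quot sf_rel}.
HB.instance Definition _ := Choice.on sf_class.
HB.instance Definition _ := EqQuotient.on sf_class.

Definition sf_class_of (b : symForm) : sf_class :=
  \pi_sf_class (coord_of_sf b : {classic coordForm}).

Definition sf_class_repr (x : sf_class) : symForm := sf_of_coord (repr x).

Lemma sf_class_ofP b c : sf_class_of b = sf_class_of c <-> sf_isometric b c.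
Proof.
have bb := coord_form_isometric b; have cc := coord_form_isometric c.
split=> [/eqP|h].
  rewrite /sf_class_of piE => /asboolP h.
  exact: sf_isometric_trans bb (sf_isometric_trans h (sf_isometric_sym cc)).
apply/eqP; rewrite /sf_class_of piE; apply/asboolP.
exact: sf_isometric_trans (sf_isometric_sym bb) (sf_isometric_trans h cc).
Qed.

Lemma sf_class_reprK x : sf_class_of (sf_class_repr x) = x.
Proof.
rewrite -[RHS]reprK; apply/eqP; rewrite /sf_class_of piE; apply/asboolP.
exact/sf_isometric_sym/coord_form_isometric.
Qed.

Definition sf_class_add (x y : sf_class) : sf_class :=
  sf_class_of (sf_orth (sf_class_repr x) (sf_class_repr y)).

Lemma sf_class_addE b c :
  sf_class_add (sf_class_of b) (sf_class_of c) = sf_class_of (sf_orth b c).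
Proof.
by apply/sf_class_ofP/sf_orth_isometric; apply/sf_class_ofP/sf_class_reprK.
Qed.

Lemma sf_class_addA : associative sf_class_add.
Proof.
move=> x y z; rewrite -(sf_class_reprK x) -(sf_class_reprK y) -(sf_class_reprK z).
by rewrite !sf_class_addE; apply/sf_class_ofP/sf_orthA.
Qed.

Lemma sf_class_addC : commutative sf_class_add.
Proof.
move=> x y; rewrite -(sf_class_reprK x) -(sf_class_reprK y).
by rewrite !sf_class_addE; apply/sf_class_ofP/sf_orthC.
Qed.

Lemma sf_class_add0 : left_id (sf_class_of sf_zero) sf_class_add.
Proof.
move=> x; rewrite -(sf_class_reprK x) sf_class_addE.
exact/sf_class_ofP/sf_orth0.
Qed.

HB.instance Definition _ :=
  GRing.isNmodule.Build sf_class sf_class_addA sf_class_addC sf_class_add0.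

Definition GW : zmodType := group_completion sf_class.
End GrothendieckWitt.

(* Main.v *)
From HB Require Import structures.
Require Import Defs.
From mathcomp Require Import all_boot all_order all_algebra perm sesquilinear.
From mathcomp Require Import boolp ring.
From mathcomp.multinomials Require Import freeg.

Set Implicit Arguments.
Unset Strict Implicit.
Unset Printing Implicit Defensive.

Import GRing.Theory.
Local Open Scope ring_scope.

(** Write [<a>] for the rank one form with coefficient [a]. The proof shows that
both groups are generated by classes indexed by the nonzero [a], subject to
exactly the relations collected in [gw_symbol]; they represent the same functor,
and the isomorphism matches the generators.

On the Steinberg side, the symbol [u, v] depends only on the two lines and is
additive along paths of lines, so every element of the coinvariants is a
combination of the corners [[u, v] (x) [u, w]]. A triple of distinct lines is
determined up to the special linear group by
[det(u,v) det(u,w) det(v,w)] modulo squares: this is the generator attached to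
a corner ([sym2_corner]). Subdividing [u, v] in [[u, v] (x) [u, v]], on which
the group acts transitively, shows that the generators of [a] and [-a] have a
sum independent of [a]; computing [[u1, u2] (x) [u3, u4]] by subdividing
either factor gives the relation between [a], [c] and [a + c]
([coinv_gw_symbol]). Conversely, a function satisfying the relations defines a
pairing of Steinberg modules: fix a line [e] and expand both symbols through
[e]. Invariance amounts to independence of [e], which is the three term
relation combined with the Pluecker relation ([corner_value_base_change]).

On the side of forms, the relations hold by explicit isometries. For the
universal property a form is assigned a value by splitting off anisotropic
vectors and planes that contain an isotropic vector; the point is that the
result does not depend on the choices ([form_value_unique]). This is proved by
induction on the dimension, comparing two first choices through their common
orthogonal complement. Planes cannot be avoided because symmetric forms
need not be diagonalizable in characteristic 2. *)

(** * Symbols and subspaces of a symmetric bilinear space *)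

(** The relations satisfied by the classes of rank one forms. The middle one
replaces the last one, whose right-hand side makes no sense, when [a + c = 0]. *)
Definition gw_symbol (F : fieldType) (W : zmodType) (y : F -> W) : Prop :=
  [/\ forall a c, a != 0 -> c != 0 -> y (a * c ^+ 2) = y a,
      forall a, a != 0 -> y a + y (- a) = y 1 + y (- 1)
    & forall a c, a != 0 -> c != 0 -> a + c != 0 ->
        y a + y c = y (a + c) + y (a * c * (a + c))].

Section SymmetricForm.
Variables (F : fieldType) (V : vectType F) (b : {symmetric V}).
Implicit Types (u v w n m : V) (U : {vspace V}).

Lemma sformC u v : b u v = b v u.
Proof. by rewrite hermC mul1r. Qed.
Lemma sformDl u u' v : b (u + u') v = b u v + b u' v.
Proof. exact: linearDl. Qed.
Lemma sformZl a u v : b (a *: u) v = a * b u v.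
Proof. exact: linearZl_LR. Qed.
Lemma sformNl u v : b (- u) v = - b u v.
Proof. exact: linearNl. Qed.
Lemma sformDr u v v' : b u (v + v') = b u v + b u v'.
Proof. exact: linearDr. Qed.
Lemma sformZr a u v : b u (a *: v) = a * b u v.
Proof. exact: linearZr_LR. Qed.
Lemma sformNr u v : b u (- v) = - b u v.
Proof. exact: linearNr. Qed.
Definition sformE := (sformDl, sformDr, sformNl, sformNr, sformZl, sformZr).

Definition form_with v : V -> F^o := b v.
Lemma form_with_linear v : linear (form_with v).
Proof. by move=> k u w; rewrite /form_with sformDr sformZr. Qed.
HB.instance Definition _ v := GRing.isLinear.Build F V F^o _ (form_with v) (form_with_linear v).

Definition perp U v : {vspace V} := (U :&: lker (linfun (form_with v)))%VS.

Lemma mem_perp U v w : (w \in perp U v) = (w \in U) && (b v w == 0).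
Proof. by rewrite memv_cap memv_ker lfunE. Qed.

Lemma perpP U v w : reflect (w \in U /\ b v w = 0) (w \in perp U v).
Proof. by rewrite mem_perp; apply: (iffP andP) => -[? /eqP]. Qed.

(** The pairing with [v] is a nonzero linear form on [U]. *)
Lemma dim_perp U v w : w \in U -> b v w != 0 -> \dim U = (\dim (perp U v)).+1.
Proof.
move=> wU vw; rewrite -(limg_ker_dim (linfun (form_with v)) U) -addn1; congr addn.
apply/eqP; rewrite eqn_leq; apply/andP; split.
  by have := dimvS (subvf (linfun (form_with v) @: U)); rewrite dimvf.
rewrite lt0n dimv_eq0; apply/negP => /eqP im0.
by move: (memv_img (linfun (form_with v)) wU); rewrite im0 memv0 lfunE /= (negPf vw).
Qed.

Lemma dim_perp_lt U v w : w \in U -> b v w != 0 -> (\dim (perp U v) < \dim U)%N.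
Proof. by move=> wU vw; rewrite (dim_perp wU vw). Qed.

Lemma eq_perp U v w :
  (forall z, z \in U -> b v z = 0 <-> b w z = 0) -> perp U v = perp U w.
Proof.
move=> h; apply/vspaceP => z; apply/perpP/perpP => -[zU];
  by move=> /(h z zU).
Qed.

Lemma perpC U v w : perp (perp U v) w = perp (perp U w) v.
Proof. by rewrite /perp -!capvA [X in (U :&: X)%VS]capvC. Qed.

Definition nondeg_on U := forall u, u \in U -> (forall w, w \in U -> b u w = 0) -> u = 0.

Lemma nondeg_on_partner U u : nondeg_on U -> u \in U -> u != 0 ->
  exists2 m, m \in U & b u m = 1.
Proof.
move=> ndU uU u0; apply: contrapT => H; case/eqP: u0; apply: ndU uU _ => w wU.
apply: contrapT => /eqP uw; apply: H; exists ((b u w)^-1 *: w); first exact: memvZ.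
by rewrite sformZr mulVf.
Qed.

Lemma nondeg_on_line U v : v \in U -> b v v != 0 -> nondeg_on U -> nondeg_on (perp U v).
Proof.
move=> vU v0 ndU z /perpP [zU vz] h; apply: ndU zU _ => u uU.
have hu : u - (b v u / b v v) *: v \in perp U v.
  apply/perpP; split; first by rewrite memvB ?memvZ.
  by rewrite !sformE; field.
by move: (h _ hu); rewrite !sformE (sformC z v) vz mulr0 subr0.
Qed.

(** The norm of [m] is arbitrary: in characteristic 2 it cannot be made to
vanish by changing [m] in general. *)
Definition hyperbolic_pair U n m := [/\ n \in U, m \in U, b n n = 0 & b n m = 1].

Lemma nondeg_on_plane U n m : hyperbolic_pair U n m -> nondeg_on U ->
  nondeg_on (perp (perp U n) m).
Proof.
move=> [nU mU nn nm] ndU z /perpP [/perpP [zU nz] mz] h; apply: ndU zU _ => u uU.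
have hu : u - (b m u - b n u * b m m) *: n - b n u *: m \in perp (perp U n) m.
  apply/perpP; split; first apply/perpP; first split.
  - by rewrite !memvB ?memvZ.
  - by rewrite !sformE nn nm; ring.
  - by rewrite !sformE (sformC m n) nm; ring.
by move: (h _ hu); rewrite !sformE (sformC z n) (sformC z m) nz mz !mulr0 !subr0.
Qed.

(** * The value of a form attached to a symbol *)

Variables (W : zmodType) (y : F -> W).

Definition hyp_value : W := y 1 + y (- 1).

(** The value is a relation because it depends a priori on the vectors that are
split off. Recording orthogonal complements inside one ambient space, and not
up to isometry, lets two decompositions be compared by equality of subspaces. *)
Inductive form_value : {vspace V} -> W -> Prop :=
| form_value0 : form_value 0%VS 0
| form_value_line U v p : v \in U -> b v v != 0 ->
    form_value (perp U v) p -> form_value U (y (b v v) + p)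
| form_value_plane U n m p : hyperbolic_pair U n m ->
    form_value (perp (perp U n) m) p -> form_value U (hyp_value + p).

Lemma form_value_exists U : nondeg_on U -> exists p, form_value U p.
Proof.
have [k] := ubnP (\dim U); elim: k U => // k IH U /ltnSE dU ndU.
have [->|U0] := eqVneq U 0%VS; first by exists 0; exact: form_value0.
have uU := memv_pick U; have u0 : vpick U != 0 by rewrite vpick0.
move: (vpick U) uU u0 => u uU u0.
have [m mU um] := nondeg_on_partner ndU uU u0.
have um0 : b u m != 0 by rewrite um oner_eq0.
have lt1 := dim_perp_lt mU um0.
have [uu|uu] := eqVneq (b u u) 0.
  have hp : hyperbolic_pair U u m by [].
  have [||p hq] := IH (perp (perp U u) m).
  - by apply: leq_trans (leq_trans lt1 dU); rewrite ltnS dimvS // capvSl.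
  - exact: nondeg_on_plane.
  - by exists (hyp_value + p); apply: form_value_plane hq.
have [||p hq] := IH (perp U u); first exact: leq_trans dU.
- exact: nondeg_on_line.
- by exists (y (b u u) + p); apply: form_value_line hq.
Qed.

Hypothesis ysym : gw_symbol y.

Lemma symb_sqr a c : a != 0 -> c != 0 -> y (a * c ^+ 2) = y a.
Proof. by case: ysym => h _ _; exact: h. Qed.
Lemma symb_hyp a : a != 0 -> y a + y (- a) = hyp_value.
Proof. by case: ysym => _ h _; exact: h. Qed.

(** Two orthogonal bases of a nondegenerate plane, one starting with a vector of
norm [a] and the other with a vector of norm [c], the two having product [d],
give the same sum. This is the three term relation for the norms
[d ^ 2 / a] and [(a c - d ^ 2) / a] of the components of the second vector. *)
Lemma symb_rank2 a c d : a != 0 -> c != 0 -> a * c - d ^+ 2 != 0 ->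
  y a + y (c - d ^+ 2 / a) = y c + y (a - d ^+ 2 / c).
Proof.
move=> a0 c0; set D := _ - _ => D0.
have eD1 : c - d ^+ 2 / a = D / a by rewrite /D; field.
have eD2 : a - d ^+ 2 / c = D / c by rewrite /D; field.
have [d0|d0] := eqVneq d 0.
  by rewrite d0 expr0n /= !mul0r !subr0 addrC.
have Da : D / a != 0 by rewrite mulf_neq0 ?invr_eq0.
have da : d ^+ 2 / a != 0 by rewrite mulf_neq0 ?invr_eq0 ?expf_neq0.
have eC : d ^+ 2 / a + D / a = c by rewrite /D; field.
case: ysym => _ _ /(_ _ _ da Da); rewrite eC => /(_ c0) h.
have -> : y a = y (d ^+ 2 / a).
  have -> : d ^+ 2 / a = a * (d / a) ^+ 2 by field.
  by rewrite symb_sqr // mulf_neq0 ?invr_eq0.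
rewrite eD1 h; congr (_ + _).
have -> : d ^+ 2 / a * (D / a) * c = D / c * (d * c / a) ^+ 2 by field; rewrite a0 c0.
by rewrite symb_sqr // ?eD2 // !mulf_neq0 ?invr_eq0.
Qed.

Definition form_value_unique_below k := forall U p p',
  (\dim U < k)%N -> nondeg_on U -> form_value U p -> form_value U p' -> p = p'.

(** If [v] and [w] span a nondegenerate plane, both complements contain the
complement of the plane, and the claim is the rank two case. If the plane is
degenerate, a combination [n] of [v] and [w] is isotropic and orthogonal to both
(and it is zero only when the two lines coincide);
completing [n] to hyperbolic pairs in the two complements leaves the same
subspace, although the complements need not be isometric in characteristic 2. *)
Lemma form_value_line_line U v w p p' :
  form_value_unique_below (\dim U) -> nondeg_on U ->
  v \in U -> w \in U -> b v v != 0 -> b w w != 0 ->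
  form_value (perp U v) p -> form_value (perp U w) p' -> y (b v v) + p = y (b w w) + p'.
Proof.
move=> IH ndU vU wU vv ww hp hp'.
have ndv := nondeg_on_line vU vv ndU; have ndw := nondeg_on_line wU ww ndU.
have ltv := dim_perp_lt vU vv; have ltw := dim_perp_lt wU ww.
have bwv : b w v = b v w by exact: sformC.
have [D0|D0] := eqVneq (b v v * b w w - b v w ^+ 2) 0; last first.
  pose v' := w - (b v w / b v v) *: v; pose w' := v - (b v w / b w w) *: w.
  have v'U : v' \in perp U v.
    by apply/perpP; split; [rewrite memvB ?memvZ | rewrite !sformE; field].
  have w'U : w' \in perp U w.
    by apply/perpP; split; [rewrite memvB ?memvZ | rewrite !sformE bwv; field].
  have qv' : b v' v' = b w w - b v w ^+ 2 / b v v.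
    by rewrite !sformE bwv; field.
  have qw' : b w' w' = b v v - b v w ^+ 2 / b w w.
    by rewrite !sformE bwv; field.
  have v'0 : b v' v' != 0.
    by rewrite qv'; apply: contraNneq D0 => h; apply/eqP; rewrite -(mulr0 (b v v)) -h; field.
  have w'0 : b w' w' != 0.
    by rewrite qw'; apply: contraNneq D0 => h; apply/eqP; rewrite -(mulr0 (b w w)) -h; field.
  have e1 : perp (perp U v) v' = perp (perp U v) w.
    apply: eq_perp => z /perpP [_ vz]; rewrite !sformE vz mulr0 subr0; tauto.
  have e2 : perp (perp U w) w' = perp (perp U v) w.
    rewrite perpC (perpC U v w); rewrite perpC; apply: eq_perp => z /perpP [_ wz].
    by rewrite !sformE wz mulr0 subr0; tauto.
  have [p0 h0] := form_value_exists (nondeg_on_line v'U v'0 ndv).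
  have -> := IH _ _ _ ltv ndv hp (form_value_line v'U v'0 h0).
  rewrite e1 -e2 in h0.
  have -> := IH _ _ _ ltw ndw hp' (form_value_line w'U w'0 h0).
  by rewrite qv' qw' !addrA symb_rank2.
have vw : b v w != 0.
  apply: contraTneq isT => vw; move/eqP: D0.
  by rewrite vw expr0n subr0 mulf_eq0 (negPf vv) (negPf ww).
have ew : b w w = b v w ^+ 2 / b v v.
  apply/eqP; rewrite -subr_eq0 -(mulrI_eq0 _ (mulfI vv)); apply/eqP.
  by rewrite -D0; field.
have -> : y (b w w) = y (b v v).
  have -> : b w w = b v v * (b v w / b v v) ^+ 2 by rewrite ew; field.
  by rewrite symb_sqr // mulf_neq0 ?invr_eq0.
congr (_ + _).
(* The radical of the plane: the factor makes it orthogonal to [v]. *)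
pose n := (b v v / b v w) *: w - v.
have nU : n \in U by rewrite memvB ?memvZ.
have bnz z : b n z = b v v / b v w * b w z - b v z by rewrite !sformE.
have nv : b n v = 0 by rewrite bnz bwv; field.
have nw : b n w = 0 by rewrite bnz ew; field; rewrite vv vw.
have nn : b n n = 0 by rewrite /n sformDr sformNr sformZr -/n nv nw; ring.
clearbody n.
have [n0|n0] := eqVneq n 0.
  suff e : perp U v = perp U w by apply: (IH _ _ _ ltw) => //; rewrite -e.
  apply: eq_perp => z zU; have := bnz z; rewrite n0 (linear0l b) => h.
  split=> hz; move: h; rewrite hz ?mulr0 ?subr0 ?sub0r => /esym/eqP.
    by rewrite mulf_eq0 mulf_eq0 invr_eq0 (negPf vv) (negPf vw) => /eqP.
  by rewrite oppr_eq0 => /eqP.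
have [m mU nm] := nondeg_on_partner ndU nU n0.
have plane u : u \in U -> b u u != 0 -> b n u = 0 ->
   hyperbolic_pair (perp U u) n (m - (b u m / b u u) *: u) /\
   perp (perp (perp U u) n) (m - (b u m / b u u) *: u) = perp (perp (perp U u) n) m.
  move=> uU uu nu; split; first split.
  - by apply/perpP; rewrite sformC.
  - by apply/perpP; split; [rewrite memvB ?memvZ | rewrite !sformE; field].
  - by [].
  - by rewrite !sformE nu nm; ring.
  - apply: eq_perp => z /perpP [/perpP [_ uz] _].
    by rewrite !sformE uz mulr0 subr0; tauto.
have [hv ev] := plane v vU vv nv; have [hw ew'] := plane w wU ww nw.
have e : perp (perp (perp U v) n) m = perp (perp (perp U w) n) m.
  congr (perp _ m); rewrite ![perp (perp U _) n]perpC; apply: eq_perp => z /perpP [_].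
  rewrite bnz => h; split=> hz; move: h; rewrite hz ?mulr0 ?subr0 ?sub0r => /eqP.
    by rewrite mulf_eq0 mulf_eq0 invr_eq0 (negPf vv) (negPf vw) => /eqP.
  by rewrite oppr_eq0 => /eqP.
have [p0 h0] := form_value_exists (nondeg_on_plane hv ndv).
rewrite (IH _ _ _ ltv ndv hp (form_value_plane hv h0)).
rewrite ev e -ew' in h0.
by rewrite (IH _ _ _ ltw ndw hp' (form_value_plane hw h0)).
Qed.

(** The plane also splits as [m] and [m - b m m *: n], of opposite norms, so this
reduces to the comparison of [v] with [m]. *)
Lemma form_value_line_plane_aniso U v n m p p' :
  form_value_unique_below (\dim U) -> nondeg_on U ->
  v \in U -> b v v != 0 -> hyperbolic_pair U n m -> b m m != 0 ->
  form_value (perp U v) p -> form_value (perp (perp U n) m) p' -> y (b v v) + p = hyp_value + p'.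
Proof.
move=> IH ndU vU vv [nU mU nn nm] mm hp hp'.
pose m' := m - b m m *: n.
have m'U : m' \in perp U m.
  by apply/perpP; split; [rewrite memvB ?memvZ | rewrite !sformE (sformC m n) nm; ring].
have qm' : b m' m' = - b m m by rewrite !sformE nn (sformC m n) nm; ring.
have m'0 : b m' m' != 0 by rewrite qm' oppr_eq0.
have e : perp (perp U m) m' = perp (perp U n) m.
  rewrite (perpC U n m); apply: eq_perp => z /perpP [_ mz].
  rewrite !sformE mz sub0r; split=> [/eqP|->]; last by rewrite mulr0 oppr0.
  by rewrite oppr_eq0 mulf_eq0 (negPf mm) => /eqP.
rewrite -e in hp'; have hm := form_value_line m'U m'0 hp'.
by rewrite (form_value_line_line IH ndU vU mU vv mm hp hm) addrA qm' symb_hyp.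
Qed.

(** When [m] is isotropic, [m + n] has norm 2 and spans the same plane with [n];
in characteristic 2, the norm is additive on orthogonal sums with the plane and
vanishes on the plane, so the projection [r] of [v] off the plane has the norm
of [v] and is orthogonal to the plane. *)
Lemma form_value_line_plane_uniq U v n m p p' :
  form_value_unique_below (\dim U) -> nondeg_on U ->
  v \in U -> b v v != 0 -> hyperbolic_pair U n m ->
  form_value (perp U v) p -> form_value (perp (perp U n) m) p' -> y (b v v) + p = hyp_value + p'.
Proof.
move=> IH ndU vU vv hnm hp hp'; have [nU mU nn nm] := hnm.
have [mm|mm] := eqVneq (b m m) 0; last first.
  exact: (form_value_line_plane_aniso IH ndU vU vv hnm).
have [two|two] := eqVneq (1 + 1 : F) 0; last first.
  apply: (@form_value_line_plane_aniso U v n (m + n)) => //.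
  - by split; rewrite ?memvD // sformE nm nn addr0.
  - by rewrite !sformE (sformC m n) mm nn nm add0r addr0.
  - suff -> : perp (perp U n) (m + n) = perp (perp U n) m by [].
    by apply: eq_perp => z /perpP [_ nz]; rewrite sformE nz addr0.
pose r := v - b v m *: n - b v n *: m.
have rU : r \in U by rewrite !memvB ?memvZ.
have nr : b n r = 0 by rewrite !sformE nn nm (sformC v n); ring.
have mr : b m r = 0 by rewrite !sformE mm (sformC m n) nm (sformC v m); ring.
have rE z : b r z = b v z - b v m * b n z - b v n * b m z by rewrite !sformE.
clearbody r.
have rr : b r r = b v v.
  rewrite rE nr mr (sformC v r) rE (sformC n v) (sformC m v).
  transitivity (b v v - (1 + 1) * (b v n * b v m)); first ring.
  by rewrite two mul0r subr0.
have r0 : b r r != 0 by rewrite rr.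
have rP : r \in perp (perp U n) m by apply/perpP; split=> //; apply/perpP.
have ndP := nondeg_on_plane hnm ndU.
have [p3 h3] := form_value_exists (nondeg_on_line rP r0 ndP).
have ltP : (\dim (perp (perp U n) m) < \dim U)%N.
  apply: leq_ltn_trans (@dim_perp_lt U n m mU _); last by rewrite nm oner_eq0.
  by rewrite dimvS // capvSl.
have hnm' : hyperbolic_pair (perp U r) n m by split=> //; apply/perpP; rewrite sformC.
have e : perp (perp (perp U n) m) r = perp (perp (perp U r) n) m.
  by rewrite perpC (perpC U n r).
rewrite (IH _ _ _ ltP ndP hp' (form_value_line rP r0 h3)).
rewrite e in h3.
by rewrite (form_value_line_line IH ndU vU rU vv r0 hp (form_value_plane hnm' h3)) rr addrCA.
Qed.

(** With no anisotropic vector only planes can be split off. *)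
Lemma form_value_alternate U p : form_value U p -> (forall u, u \in U -> b u u = 0) ->
  p = hyp_value *+ (\dim U)./2.
Proof.
elim=> {U p} [_|U v p vU vv _ _ /(_ v vU)/eqP|U n m p [nU mU nn nm] _ IH alt].
- by rewrite dimv0.
- by rewrite (negPf vv).
rewrite IH => [|u /perpP [/perpP [uU _] _]]; last exact: alt.
have nm0 : b n m != 0 by rewrite nm oner_eq0.
have nP : n \in perp U n by apply/perpP.
have mn0 : b m n != 0 by rewrite sformC.
by rewrite (dim_perp mU nm0) (dim_perp nP mn0) mulrS.
Qed.

(** Any two first steps are compared with a step along a fixed anisotropic
vector, if there is one. *)
Theorem form_value_unique U p p' : nondeg_on U -> form_value U p -> form_value U p' -> p = p'.
Proof.
have [k] := ubnP (\dim U); elim: k U p p' => // k IHk U p p' /ltnSE dU ndU.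
have {dU} IH : form_value_unique_below (\dim U).
  by move=> U' q q' dU'; apply: IHk; exact: leq_trans dU' dU.
have no0 u : u \in (0%VS : {vspace V}) -> b u u = 0.
  by rewrite memv0 => /eqP ->; exact: linear0r.
move=> hp hp'.
have [[v vU vv]|alt] := pselect (exists2 v, v \in U & b v v != 0); last first.
  have {}alt u : u \in U -> b u u = 0.
    by move=> uU; apply: contrapT => /eqP uu; apply: alt; exists u.
  by rewrite (form_value_alternate hp alt) (form_value_alternate hp' alt).
have [q hq] := form_value_exists (nondeg_on_line vU vv ndU).
suff H p0 : form_value U p0 -> y (b v v) + q = p0 by rewrite -(H _ hp) (H _ hp').
move=> {p p' hp hp'} hp0.
case: hp0 ndU vU hq IH => {U p0} [|U w p wU ww hp|U n m p hnm hp] ndU vU hq IH.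
- by rewrite (no0 v vU) eqxx in vv.
- exact: form_value_line_line IH ndU vU wU vv ww hq hp.
- exact: form_value_line_plane_uniq IH ndU vU vv hnm hq hp.
Qed.

End SymmetricForm.

(** Taking the zero space for [U'] gives invariance under isometries, and taking
[U'] to be the image of a second summand gives additivity. *)
Lemma form_value_embed (F : fieldType) (V V' : vectType F) (b : {symmetric V})
    (b' : {symmetric V'}) (g : {linear V -> V'}) (W : zmodType) (y : F -> W)
    (U : {vspace V}) p (U' : {vspace V'}) p' :
  isometry b' b g -> form_value b y U p ->
  (forall u u', u \in U -> u' \in U' -> b' (g u) u' = 0) ->
  form_value b' y U' p' -> form_value b' y (linfun g @: U + U')%VS (p + p').
Proof.
move=> iso hp; have mem_sum (U0 : {vspace V}) z :
    reflect (exists u u', [/\ u \in U0, u' \in U' & z = g u + u'])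
      (z \in (linfun g @: U0 + U')%VS).
  apply: (iffP memv_addP) => [[_ /memv_imgP [u uU ->] [u' u'U ->]]|[u [u' [uU u'U ->]]]].
    by exists u, u'; rewrite lfunE.
  by exists (g u); [rewrite -[g u](lfunE g) memv_img | exists u'].
have perp_sum (U0 : {vspace V}) v : (forall u', u' \in U' -> b' (g v) u' = 0) ->
    perp b' (linfun g @: U0 + U')%VS (g v) = (linfun g @: perp b U0 v + U')%VS.
  move=> vU'; apply/vspaceP => z; apply/perpP/mem_sum.
    move=> [/mem_sum [u [u' [uU u'U ->]]]]; rewrite sformDr iso vU' // addr0 => vu.
    by exists u, u'; split=> //; apply/perpP.
  move=> [u [u' [/perpP [uU vu] u'U ->]]]; split.
    by apply/mem_sum; exists u, u'.
  by rewrite sformDr iso vu vU' // addr0.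
have gU (U0 : {vspace V}) u : u \in U0 -> g u \in (linfun g @: U0 + U')%VS.
  by move=> uU; apply/mem_sum; exists u, 0; rewrite mem0v addr0.
elim: hp => {U p} [|U v p vU vv _ IH|U n m p [nU mU nn nm] _ IH] ort hp'.
- by rewrite limg0 add0v add0r.
- rewrite -addrA -iso; apply: form_value_line; rewrite ?gU ?iso //.
  rewrite perp_sum => [|u' u'U]; last exact: ort.
  by apply: IH => // u u' /perpP [uU _]; exact: ort.
- rewrite -addrA; apply: (@form_value_plane _ _ _ _ _ _ (g n) (g m)).
    by split; rewrite ?gU ?iso.
  rewrite !perp_sum => [|u' u'U|u' u'U]; [|exact: ort..].
  by apply: IH => // u u' /perpP [/perpP [uU _] _]; exact: ort.
Qed.

Section Summands.
Variables (F : fieldType) (V W : vectType F).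
Definition orth_inl (u : V) : V * W := (u, 0).
Definition orth_inr (u : W) : V * W := (0, u).
Lemma orth_inl_linear : linear orth_inl.
Proof. by move=> k u v; congr (_, _); rewrite /= scaler0 addr0. Qed.
Lemma orth_inr_linear : linear orth_inr.
Proof. by move=> k u v; congr (_, _); rewrite /= scaler0 addr0. Qed.
HB.instance Definition _ := GRing.isLinear.Build F V (V * W)%type _ orth_inl orth_inl_linear.
HB.instance Definition _ := GRing.isLinear.Build F W (V * W)%type _ orth_inr orth_inr_linear.
End Summands.

Section SymFormValue.
Variables (F : fieldType) (W : zmodType) (y : F -> W).
Implicit Types (B C : symForm F).

Lemma sf_nondeg_on B : nondeg_on (sf_form B) fullv.
Proof.
have /nondegenerateP h := sf_nondeg B.
by move=> u _ hu; apply: h => v; apply: hu; rewrite memvf.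
Qed.

Definition sf_val B : W := sval (cid (form_value_exists y (sf_nondeg_on (B := B)))).

Lemma sf_valP B : form_value (sf_form B) y fullv (sf_val B).
Proof. by rewrite /sf_val; case: cid. Qed.

Hypothesis ysym : gw_symbol y.

Lemma sf_val_unique B p : form_value (sf_form B) y fullv p -> sf_val B = p.
Proof. exact: form_value_unique ysym _ _ _ (@sf_nondeg_on B) (sf_valP B). Qed.

Lemma sf_val_isometric B C : sf_isometric B C -> sf_val B = sf_val C.
Proof.
case=> g [[g' _ gK] iso]; apply/esym/sf_val_unique.
have := form_value_embed iso (sf_valP B) _ (form_value0 (sf_form C) y).
rewrite addr0 addv0 (_ : (linfun g @: fullv)%VS = fullv); first apply.
  by move=> u u' _; rewrite memv0 => /eqP ->; exact: linear0r.
by apply/vspaceP => z; rewrite memvf -[z]gK -[g _](lfunE g) memv_img ?memvf.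
Qed.

Lemma sf_val_orth B C : sf_val (sf_orth B C) = sf_val B + sf_val C.
Proof.
pose b := sf_form (sf_orth B C).
pose gl := @orth_inl F (sf_space B) (sf_space C); pose gr := @orth_inr F (sf_space B) (sf_space C).
have isol : isometry b (sf_form B) gl.
  by move=> u v; rewrite /b /= /orth_form /= linear0r addr0.
have isor : isometry b (sf_form C) gr.
  by move=> u v; rewrite /b /= /orth_form /= linear0r add0r.
have hr := form_value_embed isor (sf_valP C) _ (form_value0 b y).
have {}hr := hr _; rewrite addr0 addv0 in hr.
have hl := form_value_embed isol (sf_valP B) _ (hr _).
apply: sf_val_unique.
rewrite (_ : fullv = (linfun gl @: fullv + linfun gr @: fullv)%VS).
  apply: hl => [u u' _ /memv_imgP [v _ ->]|u u' _]; last first.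
    by rewrite memv0 => /eqP ->; exact: linear0r.
  by rewrite lfunE /b /= /orth_form /= linear0l linear0r addr0.
apply/esym/vspaceP => -[u v]; rewrite memvf; apply/memv_addP.
exists (gl u); first by rewrite -[gl u](lfunE gl) memv_img ?memvf.
exists (gr v); first by rewrite -[gr v](lfunE gr) memv_img ?memvf.
by congr (_, _); rewrite ?addr0 ?add0r.
Qed.

End SymFormValue.

(** * Rank one generators of the Grothendieck-Witt group *)

Section GrothendieckWittGenerators.
Variable F : fieldType.
Implicit Types (B C : symForm F).

Definition GW_class B : GW F := zproj (@completion_rel (sf_class F)) (fgen (sf_class_of B)).

Lemma GW_class_isometric B C : sf_isometric B C -> GW_class B = GW_class C.
Proof. by move/sf_class_ofP => e; rewrite /GW_class e. Qed.

Lemma GW_class_orth B C : GW_class (sf_orth B C) = GW_class B + GW_class C.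
Proof.
rewrite /GW_class -(raddfD (zproj _)); apply/zproj_eq/zgen_rel.
by rewrite -sf_class_addE; exact: completion_relD.
Qed.

Lemma GW_class_zero : GW_class (sf_zero F) = 0.
Proof.
apply: (addrI (GW_class (sf_zero F))); rewrite addr0 -GW_class_orth.
exact/GW_class_isometric/sf_orth0.
Qed.

Section Line.
Variable a : F.
(** Replacing the coefficient 0 by 1 makes the form nondegenerate for every [a]. *)
Definition line_coef : F := if a == 0 then 1 else a.
Lemma line_coef_neq0 : line_coef != 0.
Proof. by rewrite /line_coef; case: (eqVneq a 0) => // _; exact: oner_neq0. Qed.
Definition line_form (u v : F^o) : F := line_coef * ((u : F) * (v : F)).
Lemma line_form_bilinear :
  bilinear_for (GRing.Scale.Law.clone F F *%R _)
    (GRing.Scale.Law.clone F F (idfun \; *%R) _) line_form.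
Proof.
by split=> [w k u v|w k u v]; rewrite /line_form /GRing.scale /=; ring.
Qed.
HB.instance Definition _ :=
  bilinear_isBilinear.Build F _ _ _ _ _ line_form line_form_bilinear.
Lemma line_form_sym u v : line_form u v = (-1) ^+ false * idfun (line_form v u).
Proof. by rewrite /line_form /=; ring. Qed.
HB.instance Definition _ :=
  isHermitianSesquilinear.Build F _ false idfun line_form line_form_sym.
Lemma line_form_nondegenerate : nondegenerate line_form.
Proof.
apply/nondegenerateP => u /(_ (1 : F)) /eqP.
by rewrite /= /line_form mulr1 mulf_eq0 (negPf line_coef_neq0) => /eqP.
Qed.
Definition sf_line : symForm F := SymForm line_form_nondegenerate.
End Line.

Section Plane.
Variable d : F.
Definition plane_form (u v : F^o * F^o) : F :=
  (u.1 : F) * (v.2 : F) + (u.2 : F) * (v.1 : F) + d * ((u.2 : F) * (v.2 : F)).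
Lemma plane_form_bilinear :
  bilinear_for (GRing.Scale.Law.clone F F *%R _)
    (GRing.Scale.Law.clone F F (idfun \; *%R) _) plane_form.
Proof.
split=> [w k u v|w k u v]; rewrite /plane_form /= /GRing.scale /=; ring.
Qed.
HB.instance Definition _ :=
  bilinear_isBilinear.Build F _ _ _ _ _ plane_form plane_form_bilinear.
Lemma plane_form_sym u v : plane_form u v = (-1) ^+ false * idfun (plane_form v u).
Proof. by rewrite /plane_form /=; ring. Qed.
HB.instance Definition _ :=
  isHermitianSesquilinear.Build F _ false idfun plane_form plane_form_sym.
Lemma plane_form_nondegenerate : nondegenerate plane_form.
Proof.
apply/nondegenerateP => -[s t] h; move: (h (1, 0)) (h (0, 1)).
rewrite /= /plane_form /= !mulr0 !mulr1 !add0r !addr0 => ->.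
by rewrite mulr0 addr0 => ->.
Qed.
Definition sf_plane : symForm F := SymForm plane_form_nondegenerate.
End Plane.

Definition gw (a : F) : GW F := GW_class (sf_line a).

Lemma sf_planeE d (u v : F^o * F^o) : sf_form (sf_plane d) u v = plane_form d u v.
Proof. by []. Qed.
Lemma sf_lineE a (u v : F^o) : a != 0 -> sf_form (sf_line a) u v = a * ((u : F) * (v : F)).
Proof. by move=> a0; rewrite /= /line_form /line_coef (negPf a0). Qed.
Lemma sf_orthE B C (u v : sf_space B * sf_space C) :
  sf_form (sf_orth B C) u v = sf_form B u.1 v.1 + sf_form C u.2 v.2.
Proof. by []. Qed.

Lemma gw_sqr a c : a != 0 -> c != 0 -> gw (a * c ^+ 2) = gw a.
Proof.
move=> a0 c0; apply: GW_class_isometric.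
apply: (@sf_isometricI _ (sf_line _) (sf_line _) (fun u => c * (u : F))).
- by move=> k u v; rewrite /= /GRing.scale /=; ring.
- by exists (fun u : F => c^-1 * u) => u; rewrite mulrA (mulfV, mulVf) ?mul1r.
- by move=> u v; rewrite !sf_lineE ?mulf_neq0 ?expf_neq0 //; ring.
Qed.

Lemma gw_add a c : a != 0 -> c != 0 -> a + c != 0 ->
  gw a + gw c = gw (a + c) + gw (a * c * (a + c)).
Proof.
move=> a0 c0 ac0; rewrite /gw -!GW_class_orth; apply/esym/GW_class_isometric.
apply: (@sf_isometricI _ (sf_orth (sf_line _) (sf_line _)) (sf_orth (sf_line _) (sf_line _))
  (fun u => ((u.1 : F) + c * (u.2 : F), (u.1 : F) - a * (u.2 : F)))).
- by move=> k [s t] [s' t']; congr (_, _); rewrite /= /GRing.scale /=; ring.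
- exists (fun u => ((a * (u.1 : F) + c * (u.2 : F)) / (a + c), ((u.1 : F) - (u.2 : F)) / (a + c)));
    by case=> s t; congr (_, _); rewrite /=; field.
- by move=> [s t] [s' t']; rewrite !sf_orthE /= !sf_lineE ?mulf_neq0 //; ring.
Qed.

(** After adding a line of norm [t], the vector of norm [d] in the plane can be
changed by the generator of that line, which adds [t] to its norm. *)
Lemma GW_class_plane_indep d e : GW_class (sf_plane d) = GW_class (sf_plane e).
Proof.
have [->//|] := eqVneq e d; rewrite -subr_eq0; set t := e - d => t0.
apply: (addIr (gw t)); rewrite /gw -!GW_class_orth; apply/esym/GW_class_isometric.
apply: (@sf_isometricI _ (sf_orth (sf_plane _) (sf_line _)) (sf_orth (sf_plane _) (sf_line _))
  (fun u => (((u.1.1 : F) - t * (u.2 : F), u.1.2), (u.1.2 : F) + (u.2 : F)))).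
- by move=> k [[x1 x2] x3] [[y1 y2] y3]; congr (_, _, _); rewrite /= /GRing.scale /=; ring.
- exists (fun u => (((u.1.1 : F) + t * ((u.2 : F) - (u.1.2 : F)), u.1.2), (u.2 : F) - (u.1.2 : F)));
    by case=> [[x1 x2] x3]; congr (_, _, _); rewrite /=; ring.
- move=> [[x1 x2] x3] [[y1 y2] y3]; rewrite !sf_orthE !sf_planeE !sf_lineE // /plane_form /=.
  by rewrite /t; ring.
Qed.

Lemma GW_class_plane d a : a != 0 -> GW_class (sf_plane d) = gw a + gw (- a).
Proof.
move=> a0; rewrite (GW_class_plane_indep d a) /gw -GW_class_orth.
apply/esym/GW_class_isometric.
apply: (@sf_isometricI _ (sf_orth (sf_line _) (sf_line _)) (sf_plane _)
  (fun u => (- a * (u.2 : F), (u.1 : F) + (u.2 : F)))).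
- by move=> k [s t] [s' t']; congr (_, _); rewrite /= /GRing.scale /=; ring.
- exists (fun u => ((u.2 : F) + (u.1 : F) / a, - (u.1 : F) / a));
    by case=> s t; congr (_, _); rewrite /=; field.
- move=> [s t] [s' t']; rewrite !sf_orthE sf_planeE /= !sf_lineE ?oppr_eq0 // /plane_form /=.
  by ring.
Qed.

Theorem gw_is_symbol : gw_symbol gw.
Proof.
split; [exact: gw_sqr | | exact: gw_add].
by move=> a a0; rewrite -(GW_class_plane 0 a0) (GW_class_plane 0 (oner_neq0 F)).
Qed.

End GrothendieckWittGenerators.

(** * Maps out of free groups and quotients *)

Lemma freeab_ind (T : choiceType) (P : freeab T -> Prop) :
  P 0 -> (forall x, P (fgen x)) -> (forall x y, P x -> P y -> P (x - y)) -> forall x, P x.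
Proof.
move=> P0 Pgen PB x.
have PN y : P y -> P (- y) by move=> Py; rewrite -sub0r; exact: PB.
have PD y z : P y -> P z -> P (y + z) by move=> Py Pz; rewrite -[z]opprK; apply/PB/PN.
have PM y k : P y -> P (y *~ k).
  move=> Py; have PMn j : P (y *+ j) by elim: j => [|j IH] //; rewrite mulrS; exact: PD.
  by case: k => j; [rewrite -pmulrn | rewrite NegzE mulrNz -pmulrn; apply: PN].
rewrite -[x]freeg_sumE; apply: (big_ind P) => // t _.
by rewrite -[coeff t x]intz -freegU_mulz; exact/PM/Pgen.
Qed.

Lemma freeab_ext (T : choiceType) (W : zmodType) (f g : {additive freeab T -> W}) :
  (forall x, f (fgen x) = g (fgen x)) -> f =1 g.
Proof.
move=> fg; elim/freeab_ind=> [|//|x z fx fz]; first by rewrite !raddf0.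
by rewrite !raddfB fx fz.
Qed.

Lemma zquot_ext (V W : zmodType) (S : V -> Prop) (f g : {additive zquot S -> W}) :
  (forall v, f (zproj S v) = g (zproj S v)) -> f =1 g.
Proof. by move=> fg x; rewrite -(zreprK x) fg. Qed.

Lemma zquot_lift (V W : zmodType) (S : V -> Prop) (f : {additive V -> W}) :
  (forall v, S v -> f v = 0) ->
  exists g : {additive zquot S -> W}, forall v, g (zproj S v) = f v.
Proof.
move=> fS; have fB : zmod_morphism f by move=> u v; exact: raddfB.
pose g (x : zquot S) : W := f (zrepr x).
have gB : zmod_morphism g := zlift_zmod_morphism fB fS.
exists (HB.pack_for {additive zquot S -> W} g (GRing.isZmodMorphism.Build _ _ g gB)).
exact: (zlift_proj fB fS).
Qed.

(** * The universal property of the Grothendieck-Witt group *)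

Section Realization.
Variables (F : fieldType) (V : vectType F) (b : {symmetric V}).

(** For the tautological symbol, the splitting that computes the value is an
isometry with an orthogonal sum of standard lines and planes. Consequently the
rank one classes generate the Grothendieck-Witt group. *)
Lemma form_value_realized U p : form_value b (@gw F) U p ->
  exists (B : symForm F) (g : {linear sf_space B -> V}),
  [/\ forall z, z \in U <-> exists t, z = g t, isometry b (sf_form B) g & GW_class B = p].
Proof.
elim=> {U p} [|U v p vU vv _ [B [g [gU iso <-]]]|U n m p [nU mU nn nm] _ [B [g [gU iso <-]]]].
- exists (sf_zero F), (\0 : {linear _ -> _}); split; last exact: GW_class_zero.
    move=> z; rewrite memv0; split=> [/eqP ->|[t ->]]; last exact: eqxx.
    by exists 0.
  by move=> s t /=; rewrite linear0l.
- have vg t : b v (g t) = 0 by case/perpP: (iffRL (gU _) (ex_intro _ t erefl)).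
  have ggU t : g t \in U by case/perpP: (iffRL (gU _) (ex_intro _ t erefl)).
  pose B' := sf_orth (sf_line (b v v)) B.
  pose h (u : F^o * sf_space B) : V := (u.1 : F) *: v + g u.2.
  have hL : linear h.
    move=> k [s t] [s' t']; rewrite /h /= linearP scalerDr scalerA addrACA.
    by rewrite -scalerDl.
  exists B', (HB.pack_for {linear sf_space B' -> V} h (GRing.isLinear.Build _ _ _ _ h hL)).
  split; last by rewrite GW_class_orth.
  + move=> z; split=> [zU|[[s t] ->]]; last by rewrite memvD ?memvZ.
    have : z - (b v z / b v v) *: v \in perp b U v.
      by apply/perpP; split; [rewrite memvB ?memvZ | rewrite !sformE; field].
    case/gU => t ht; exists (b v z / b v v, t).
    by rewrite /= /h /= -ht addrC subrK.
  + move=> [s t] [s' t']; rewrite sf_orthE sf_lineE //= /h /= !sformE iso.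
    by rewrite (sformC b (g t)) !vg; ring.
- have ngm t : [/\ b n (g t) = 0, b m (g t) = 0 & g t \in U].
    by case/perpP: (iffRL (gU _) (ex_intro _ t erefl)) => /perpP [].
  pose B' := sf_orth (sf_plane (b m m)) B.
  pose h (u : (F^o * F^o) * sf_space B) : V := (u.1.1 : F) *: n + (u.1.2 : F) *: m + g u.2.
  have hL : linear h.
    move=> k [[s1 s2] t] [[s1' s2'] t']; rewrite /h /= linearP !scalerDr !scalerA.
    rewrite [RHS]addrACA; congr (_ + _); rewrite addrACA.
    by rewrite -!scalerDl.
  exists B', (HB.pack_for {linear sf_space B' -> V} h (GRing.isLinear.Build _ _ _ _ h hL)).
  split; last by rewrite GW_class_orth (GW_class_plane _ (oner_neq0 F)).
  + move=> z; split=> [zU|[[[s1 s2] t] ->]]; last first.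
      by have [_ _ gtU] := ngm t; rewrite !memvD ?memvZ.
    (* The coordinates of the projection of [z] to the plane. *)
    pose s1 := b m z - b n z * b m m; pose s2 := b n z.
    have : z - (s1 *: n + s2 *: m) \in perp b (perp b U n) m.
      apply/perpP; split; first apply/perpP; first split.
      * by rewrite memvB ?memvD ?memvZ.
      * by rewrite !sformE nn nm /s2; ring.
      * by rewrite !sformE (sformC b m n) nm /s1 /s2; ring.
    case/gU => t ht; exists ((s1, s2), t).
    by rewrite /= /h /= -ht addrC subrK.
  + move=> [[s1 s2] t] [[s1' s2'] t']; rewrite sf_orthE sf_planeE /plane_form /= /h /= !sformE iso.
    have [nt mt _] := ngm t; have [nt' mt' _] := ngm t'.
    rewrite (sformC b (g t) n) (sformC b (g t) m) nt mt nt' mt' (sformC b m n) nn nm; ring.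
Qed.
End Realization.

Section UniversalProperty.
Variable F : fieldType.

Lemma sf_val_gw (B : symForm F) : sf_val (@gw F) B = GW_class B.
Proof.
have [C [g [gU iso <-]]] := form_value_realized (sf_valP (@gw F) B).
apply: GW_class_isometric; apply: (@sf_isometricI _ _ _ g) => //; first exact: linearP.
have gsurj z : exists t, g t = z.
  by have [t ->] := iffLR (gU z) (memvf z); exists t.
pose g' z := sval (cid (gsurj z)).
have gK z : g (g' z) = z by rewrite /g'; case: cid.
exists g' => // t; apply/eqP; rewrite -subr_eq0; apply/eqP.
have /nondegenerateP := sf_nondeg C; apply=> s.
by rewrite -iso linearB /= gK subrr linear0l.
Qed.

Lemma GW_ext (W : zmodType) (f g : {additive GW F -> W}) :
  (forall a, a != 0 -> f (gw a) = g (gw a)) -> f =1 g.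
Proof.
move=> fg; apply: zquot_ext => D; apply: (freeab_ext (f := f \o zproj _) (g := g \o zproj _)) => c.
rewrite /= -[c]sf_class_reprK -/(GW_class _) -sf_val_gw.
elim: (sf_valP (@gw F) _) => [|U v p vU vv _ IH|U n m p hnm _ IH].
- by rewrite !raddf0.
- by rewrite !raddfD fg //; congr (_ + _).
- by rewrite !raddfD !fg ?oppr_eq0 ?oner_neq0 //; congr (_ + _).
Qed.

Theorem GW_universal (W : zmodType) (y : F -> W) : gw_symbol y ->
  exists f : {additive GW F -> W}, forall a, a != 0 -> f (gw a) = y a.
Proof.
move=> ysym; pose h (c : sf_class F) := sf_val y (sf_class_repr c).
have h_class B : h (sf_class_of B) = sf_val y B.
  by apply: (sf_val_isometric ysym); apply/sf_class_ofP/sf_class_reprK.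
have h_rel x : completion_rel x -> freeab_lift h x = 0.
  case=> c d; rewrite -(sf_class_reprK c) -(sf_class_reprK d).
  rewrite freeab_liftB freeab_liftD !freeab_liftE -[X in h X - _]/(sf_class_add _ _) sf_class_addE.
  by rewrite !h_class (sf_val_orth ysym) subrr.
have [f fE] := zquot_lift h_rel; exists f => a a0.
rewrite -[RHS](sf_val_unique ysym (B := sf_line a)).
  by rewrite -h_class; exact: etrans (fE _) (freeab_liftE _ _).

have one_a : sf_form (sf_line a) (1 : F) (1 : F) = a by rewrite sf_lineE // !mulr1.
rewrite -[y a]addr0 -[in y a]one_a; apply: form_value_line; rewrite ?memvf ?one_a //.
rewrite (_ : perp _ _ _ = 0%VS); first exact: form_value0.
apply/vspaceP => z; rewrite memv0; apply/perpP/eqP => [[_ /eqP]|->].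
  by rewrite sf_lineE // mul1r mulf_eq0 (negPf a0) => /eqP.
by rewrite memvf; split=> //; exact: linear0r.
Qed.
End UniversalProperty.

(** * Determinants in the plane and the value of a corner *)

Section PlaneVectors.
Variable F : fieldType.
Implicit Types (u v w z : 'cV[F]_2) (M : 'M[F]_2).

Definition vec2 (s t : F) : 'cV[F]_2 := \col_i (if i == 0 then s else t).

Definition cols u v : 'M[F]_2 := \matrix_(i, j) (if j == 0 then u i 0 else v i 0).

Definition det2 u v : F := u 0 0 * v 1 0 - u 1 0 * v 0 0.

Lemma ord2_eq1 (i : 'I_2) : (i == 1) = ~~ (i == 0).
Proof. by case: i => [[|[|]]]. Qed.

Lemma vec2P u v : u 0 0 = v 0 0 -> u 1 0 = v 1 0 -> u = v.
Proof.
move=> h0 h1; apply/colP => i; case: (eqVneq i 0) => [->//|].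
by rewrite -ord2_eq1 => /eqP ->.
Qed.

Lemma det_cols u v : \det (cols u v) = det2 u v.
Proof.
have l0 : fintype.lift (0 : 'I_2) (0 : 'I_1) = 1 by exact: val_inj.
have l1 : fintype.lift (1 : 'I_2) (0 : 'I_1) = 0 by exact: val_inj.
rewrite (expand_det_col _ 0) !big_ord_recl big_ord0 /cofactor !det_mx11 !mxE /= /det2.
by rewrite l0 l1 /bump /=; ring.
Qed.

Lemma mulmx_cols M u v : M *m cols u v = cols (M *m u) (M *m v).
Proof.
apply/matrixP => i j; rewrite !mxE; case: ifP => j0;
  by rewrite ?mxE; apply: eq_bigr => k _; rewrite mxE j0.
Qed.

Lemma det2_mulmx M u v : det2 (M *m u) (M *m v) = \det M * det2 u v.
Proof. by rewrite -!det_cols -mulmx_cols det_mulmx. Qed.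

Lemma det2_vec2 s t s' t' : det2 (vec2 s t) (vec2 s' t') = s * t' - t * s'.
Proof. by rewrite /det2 !mxE. Qed.

Lemma det2C u v : det2 u v = - det2 v u.
Proof. by rewrite /det2; ring. Qed.
Lemma det2vv u : det2 u u = 0.
Proof. by rewrite /det2; ring. Qed.
Lemma det2Zl k u v : det2 (k *: u) v = k * det2 u v.
Proof. by rewrite /det2 !mxE; ring. Qed.
Lemma det2Zr k u v : det2 u (k *: v) = k * det2 u v.
Proof. by rewrite /det2 !mxE; ring. Qed.
Lemma det2Dl u u' v : det2 (u + u') v = det2 u v + det2 u' v.
Proof. by rewrite /det2 !mxE; ring. Qed.
Lemma det2Dr u v v' : det2 u (v + v') = det2 u v + det2 u v'.
Proof. by rewrite /det2 !mxE; ring. Qed.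

Lemma plucker e f v w :
  det2 e f * det2 v w + det2 e w * det2 f v = det2 e v * det2 f w.
Proof. by rewrite /det2; ring. Qed.

Lemma det2_eq0 u v : u != 0 -> v != 0 -> det2 u v = 0 -> exists2 k, k != 0 & v = k *: u.
Proof.
move=> u0 v0 duv; suff [k vk] : exists k, v = k *: u.
  by exists k => //; apply: contraNneq v0 => k0; rewrite vk k0 scale0r.
have [u00|u00] := eqVneq (u 0 0) 0; last first.
  exists (v 0 0 / u 0 0); apply: vec2P; rewrite !mxE; first by field.
  by apply: (mulfI u00); rewrite (subr0_eq duv); field.
have u10 : u 1 0 != 0.
  by apply: contraNneq u0 => u10; apply/eqP/vec2P; rewrite !mxE.
exists (v 1 0 / u 1 0); apply: vec2P; rewrite !mxE; last by field.
move/eqP: duv; rewrite /det2 u00 mul0r sub0r oppr_eq0 mulf_eq0 (negPf u10) => /eqP ->.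
by rewrite mulr0.
Qed.

Lemma det2_neq0 u v : det2 u v != 0 -> u != 0 /\ v != 0.
Proof.
by move=> h; split; apply: contraNneq h => ->; rewrite -(scale0r 0) (det2Zl, det2Zr) mul0r.
Qed.

Lemma det2_decomp u w v : det2 u w != 0 ->
  v = (det2 v w / det2 u w) *: u + (det2 u v / det2 u w) *: w.
Proof.
by move=> uw0; apply: vec2P; rewrite !mxE; move: uw0; rewrite /det2 => uw0; field.
Qed.

Section CornerValue.
Variables (W : zmodType) (y : F -> W).
Hypothesis ysym : gw_symbol y.

(** The image of [[e, v] (x) [e, w]] in a group with a symbol: zero when one of the
two symbols is degenerate, and the hyperbolic value when [v] and [w] span the
same line. *)
Definition corner_value e v w : W :=
  if (det2 e v == 0) || (det2 e w == 0) then 0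
  else if det2 v w == 0 then hyp_value y else y (det2 e v * det2 e w * det2 v w).

Lemma corner_valueZ k l m e v w : k != 0 -> l != 0 -> m != 0 ->
  corner_value (k *: e) (l *: v) (m *: w) = corner_value e v w.
Proof.
move=> k0 l0 m0; rewrite /corner_value !det2Zl !det2Zr !mulf_eq0 (negPf k0) (negPf l0) (negPf m0) /=.
case: eqVneq => //= ev; case: eqVneq => //= ew; case: eqVneq => //= vw.
rewrite -(symb_sqr ysym (a := det2 e v * det2 e w * det2 v w) (c := k * l * m)) ?mulf_neq0 //.
by congr y; ring.
Qed.

Lemma corner_valueZl k v e w : k != 0 -> corner_value e (k *: v) w = corner_value e v w.
Proof. by move=> k0; rewrite -[e]scale1r -[w]scale1r corner_valueZ ?oner_neq0 // !scale1r. Qed.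
Lemma corner_valueZr k v e w : k != 0 -> corner_value e w (k *: v) = corner_value e w v.
Proof. by move=> k0; rewrite -[e]scale1r -[w]scale1r corner_valueZ ?oner_neq0 // !scale1r. Qed.
Lemma corner_valueZe k v e w : k != 0 -> corner_value (k *: e) v w = corner_value e v w.
Proof. by move=> k0; rewrite -[v]scale1r -[w]scale1r corner_valueZ ?oner_neq0 // !scale1r. Qed.

(** This is the expansion of [[f, v] (x) [f, w]] through [e], both factors being
differences of symbols starting at [e]. In general position it is the three term
relation for the two summands on the left of [plucker], scaled by the product of
the determinants of [e] with [f], [v] and [w]. *)
Lemma corner_value_base_change e f v w : e != 0 -> f != 0 -> v != 0 -> w != 0 ->
  corner_value f v w =
    corner_value e v w - corner_value e f w - corner_value e v f + corner_value e f f.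
Proof.
move=> e0 f0 v0 w0.
have corner0l x z : det2 e x = 0 -> corner_value e x z = 0 by rewrite /corner_value => ->; rewrite eqxx.
have corner0r x z : det2 e z = 0 -> corner_value e x z = 0 by rewrite /corner_value => ->; rewrite eqxx orbT.
have [ef|ef] := eqVneq (det2 e f) 0.
  by rewrite !(corner0l f) // (corner0r v f) // !subr0 addr0;
    have [k k0 ->] := det2_eq0 e0 f0 ef; rewrite corner_valueZe.
have fe : det2 f e != 0 by rewrite det2C oppr_eq0.
have -> : corner_value e f f = hyp_value y by rewrite /corner_value (negPf ef) det2vv eqxx.
have [ev|ev] := eqVneq (det2 e v) 0.
  rewrite !(corner0l v) // subr0 sub0r; have [k k0 ->] := det2_eq0 e0 v0 ev; rewrite corner_valueZl //.
  rewrite /corner_value (negPf fe) (negPf ef) /=.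
  have [fw|fw] := eqVneq (det2 f w) 0.
    have [l l0 ->] := det2_eq0 f0 w0 fw.
    by rewrite det2Zr mulf_eq0 (negPf l0) (negPf ef) /= addNr.
  have [ew|ew] := eqVneq (det2 e w) 0; first by rewrite oppr0 add0r.
  rewrite -(symb_hyp ysym (a := det2 e f * det2 e w * det2 f w)) ?mulf_neq0 // addKr.
  by rewrite (det2C f e); congr y; ring.
have [ew|ew] := eqVneq (det2 e w) 0.
  rewrite !(corner0r _ w) // subr0 sub0r; have [k k0 ->] := det2_eq0 e0 w0 ew; rewrite corner_valueZr //.
  rewrite /corner_value (negPf fe) (negPf ef) !orbF (negPf ev).
  have [fv|fv] := eqVneq (det2 f v) 0.
    have [l l0 ->] := det2_eq0 f0 v0 fv.
    by rewrite det2Zl det2vv mulr0 eqxx addNr.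
  rewrite (det2C v e) oppr_eq0 (negPf ev) (det2C v f) oppr_eq0 (negPf fv).
  rewrite -(symb_hyp ysym (a := det2 e v * det2 e f * - det2 f v)) ?mulf_neq0 ?oppr_eq0 // addKr.
  by rewrite (det2C f e); congr y; ring.
have [fv|fv] := eqVneq (det2 f v) 0.
  have [l l0 ->] := det2_eq0 f0 v0 fv.
  rewrite !corner_valueZl // subrr sub0r [corner_value f f w]/corner_value det2vv eqxx /=.
  by rewrite [corner_value e f f]/corner_value det2vv (negPf ef) eqxx addNr.
have [fw|fw] := eqVneq (det2 f w) 0.
  have [l l0 ->] := det2_eq0 f0 w0 fw.
  rewrite !corner_valueZr // [corner_value f v f]/corner_value det2vv eqxx orbT.
  by rewrite [corner_value e f f]/corner_value det2vv (negPf ef) eqxx /= addrAC subrK subrr.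
have vf : det2 v f != 0 by rewrite det2C oppr_eq0.
have [vw|vw] := eqVneq (det2 v w) 0.
  have [l l0 ->] := det2_eq0 v0 w0 vw; rewrite !corner_valueZr //.
  rewrite /corner_value det2vv eqxx (negPf fv) (negPf ev) (negPf ef) (negPf vf) /=.
  rewrite (det2C v f).
  rewrite (_ : det2 e v * det2 e f * - det2 f v = - (det2 e f * det2 e v * det2 f v)); last by ring.
  by rewrite -(addrA (hyp_value y)) -opprD symb_hyp ?mulf_neq0 // subrK.
rewrite /corner_value (negPf ev) (negPf ew) (negPf ef) (negPf fv) (negPf fw) (negPf vw) (negPf vf) /=.
have -> : det2 e v * det2 e f * det2 v f = - (det2 e f * det2 e v * det2 f v).
  by rewrite (det2C v f); ring.
rewrite -(symb_hyp ysym (a := det2 e f * det2 e v * det2 f v)) ?mulf_neq0 //.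
(* Multiplying the Pluecker relation by [X] turns each of its terms into the
   argument of a symbol, up to a square. *)
set X := det2 e f * det2 e v * det2 e w.
have X0 : X != 0 by rewrite !mulf_neq0.
have hA : det2 e v * det2 e w * det2 v w * det2 e f ^+ 2 = det2 e f * det2 v w * X by rewrite /X; ring.
have hC : det2 e f * det2 e v * det2 f v * det2 e w ^+ 2 = det2 e w * det2 f v * X by rewrite /X; ring.
have hAC : det2 e f * det2 v w * X + det2 e w * det2 f v * X = det2 e f * det2 e w * det2 f w * det2 e v ^+ 2.
  by rewrite -mulrDl plucker /X; ring.
case: ysym => _ _ /(_ (det2 e f * det2 v w * X) (det2 e w * det2 f v * X)).
rewrite hAC !mulf_neq0 ?expf_neq0 // => /(_ isT isT isT).
rewrite -hA -hC !(symb_sqr ysym) ?mulf_neq0 //.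
rewrite (_ : _ * (_ * det2 e v ^+ 2) = det2 f v * det2 f w * det2 v w * (X ^+ 2) ^+ 2); last first.
  by rewrite /X; ring.
rewrite symb_sqr ?mulf_neq0 ?expf_neq0 // => h.
rewrite [y (det2 e f * det2 e v * _) + _]addrC addrA subrK addrAC h.
by rewrite addrAC subrr add0r.
Qed.

End CornerValue.
End PlaneVectors.

(** * Steinberg symbols of pairs of vectors *)

Lemma perm2E (s : 'S_2) : s = if s 0 == 0 then 1%g else tperm 0 1.
Proof.
have s10 : s 1 != s 0 by rewrite (inj_eq perm_inj).
have two (i j k : 'I_2) : i != j -> k != j -> k = i.
  move=> ij kj; apply: val_inj; move: ij kj; rewrite -!val_eqE.
  by case: i => [[|[|?]] ?] //; case: j => [[|[|?]] ?] //; case: k => [[|[|?]] ?].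
apply/permP => k; case: (eqVneq (s 0) 0) s10 => [s0|s0] s10.
  rewrite s0 in s10; rewrite perm1; have [->//|k0] := eqVneq k 0.
  by rewrite (two 1 0 k) //; exact: (two 1 0 (s 1)).
rewrite (two 1 0 (s 0)) // in s10.
have [->|k0] := eqVneq k 0; first by rewrite tpermL; exact: (two 1 0 (s 0)).
by rewrite (two 1 0 k) // tpermR; exact: (two 0 1 (s 1)).
Qed.

Lemma mulmx_colsl (F : fieldType) (p q x : 'cV[F]_2) : cols p q *m x = x 0 0 *: p + x 1 0 *: q.
Proof.
apply/colP => i; rewrite !mxE !big_ord_recl big_ord0 !mxE /= addr0.
by rewrite (_ : fintype.lift _ _ = 1) 1?mulrC 1?[q i 0 * _]mulrC //; exact: val_inj.
Qed.

Section SteinbergSymbols.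
Variable F : fieldType.
Implicit Types (u v w z : 'cV[F]_2) (A M : GL F 2).

Lemma col_cols0 u v : col 0 (cols u v) = u.
Proof. by apply/colP => i; rewrite !mxE. Qed.
Lemma col_cols1 u v : col 1 (cols u v) = v.
Proof. by apply/colP => i; rewrite !mxE. Qed.
Lemma cols_col (A : 'M[F]_2) : cols (col 0 A) (col 1 A) = A.
Proof.
apply/matrixP => i j; rewrite !mxE; case: (eqVneq j 0) => [->//|].
by rewrite -ord2_eq1 => /eqP ->.
Qed.
Lemma set_col0 u v w : set_col (cols u v) 0 w = cols w v.
Proof. by apply/matrixP => i j; rewrite !mxE; case: (j == 0). Qed.
Lemma set_col1 u v w : set_col (cols u v) 1 w = cols u w.
Proof. by apply/matrixP => i j; rewrite !mxE ord2_eq1; case: (j == 0). Qed.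

(** Setting the symbol of two dependent vectors to zero makes
[st_sym_cocycle] hold for all nonzero vectors. *)
Definition st_sym u v : Steinberg F 2 :=
  if insub (cols u v) is Some A then Steinberg_sym A else 0.

Lemma st_symE A : Steinberg_sym A = st_sym (col 0 (A : 'M_2)) (col 1 (A : 'M_2)).
Proof. by rewrite /st_sym cols_col (valK A). Qed.

Lemma st_sym_GL u v : det2 u v != 0 ->
  exists2 A : GL F 2, A = cols u v :> 'M_2 & st_sym u v = Steinberg_sym A.
Proof.
move=> duv; rewrite /st_sym; case: insubP => [A _ eA|]; first by exists A.
by rewrite unitmxE det_cols unitfE duv.
Qed.

Lemma st_sym_degenerate u v : det2 u v = 0 -> st_sym u v = 0.
Proof.
move=> duv; rewrite /st_sym; case: insubP => [A hA _|//].
by rewrite unitmxE det_cols duv unitr0 in hA.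
Qed.

Lemma st_symZl k u v : k != 0 -> st_sym (k *: u) v = st_sym u v.
Proof.
move=> k0; have [duv|duv] := eqVneq (det2 u v) 0.
  by rewrite !st_sym_degenerate // det2Zl duv mulr0.
have [A eA ->] := st_sym_GL duv.
have [|B eB ->] := @st_sym_GL (k *: u) v; first by rewrite det2Zl mulf_neq0.
apply/esym/zproj_eq/zgen_rel; apply: (@Steinberg_rel_scale _ _ _ _ 0 k) => //.
by rewrite eA eB set_col0 col_cols0.
Qed.

Lemma st_symC u v : st_sym u v = - st_sym v u.
Proof.
have [duv|duv] := eqVneq (det2 u v) 0.
  by rewrite !st_sym_degenerate ?oppr0 // det2C duv oppr0.
have [A eA ->] := st_sym_GL duv.
have [|B eB ->] := @st_sym_GL v u; first by rewrite det2C oppr_eq0.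
rewrite -(raddfN (zproj _)); apply/zproj_eq/zgen_rel; rewrite -(mulrN1z (fgen B)).
suff -> : -1 = ((-1) ^+ (tperm (0 : 'I_2) 1) : int).
  apply: Steinberg_rel_perm; rewrite eA eB; apply/matrixP => i j; rewrite !mxE.
  have [->|] := eqVneq j 0; first by rewrite tpermL.
  by rewrite -ord2_eq1 => /eqP ->; rewrite tpermR.
by rewrite odd_tperm expr1.
Qed.

Lemma st_symZr k u v : k != 0 -> st_sym u (k *: v) = st_sym u v.
Proof. by move=> k0; rewrite st_symC st_symZl // -st_symC. Qed.

Lemma st_sym_split u v : det2 u v != 0 -> st_sym u v = st_sym (u + v) v + st_sym u (u + v).
Proof.
move=> duv; have [A eA ->] := st_sym_GL duv.
have [|B eB ->] := @st_sym_GL (u + v) v; first by rewrite det2Dl det2vv addr0.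
have [|C eC ->] := @st_sym_GL u (u + v); first by rewrite det2Dr det2vv add0r.
rewrite -(raddfD (zproj _)); apply/zproj_eq/zgen_rel.
apply: (@Steinberg_rel_add _ _ _ _ _ 0 1 1) => //; first exact: oner_neq0.
  by rewrite eA eB col_cols0 col_cols1 set_col0 scale1r.
by rewrite eA eC col_cols0 col_cols1 set_col1 scale1r.
Qed.

(** In general position, rescale [u] and [w] so that their sum is [v]. *)
Lemma st_sym_cocycle u v w : u != 0 -> v != 0 -> w != 0 -> st_sym u w = st_sym u v + st_sym v w.
Proof.
move=> u0 v0 w0; have [uv|uv] := eqVneq (det2 u v) 0.
  by rewrite (st_sym_degenerate uv) add0r; have [k k0 ->] := det2_eq0 u0 v0 uv; rewrite st_symZl.
have [vw|vw] := eqVneq (det2 v w) 0.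
  by rewrite (st_sym_degenerate vw) addr0; have [k k0 ->] := det2_eq0 v0 w0 vw; rewrite st_symZr.
have [uw|uw] := eqVneq (det2 u w) 0.
  have [k k0 ->] := det2_eq0 u0 w0 uw; rewrite !st_symZr //.
  rewrite [st_sym v u]st_symC subrr st_sym_degenerate //.
  exact: det2vv.
have ev := det2_decomp v uw; set a := det2 v w / _ in ev; set c := det2 u v / _ in ev.
have a0 : a != 0 by rewrite mulf_neq0 ?invr_eq0.
have c0 : c != 0 by rewrite mulf_neq0 ?invr_eq0.
clearbody a c.
rewrite -(st_symZl u w a0) -(st_symZr (a *: u) w c0) st_sym_split; last first.
  by rewrite det2Zl det2Zr !mulf_neq0.
by rewrite -ev st_symZr // st_symZl // addrC.
Qed.

Lemma Steinberg_act_st M u v :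
  Steinberg_act M (st_sym u v) = st_sym ((M : 'M_2) *m u) ((M : 'M_2) *m v).
Proof.
have detM : \det (M : 'M_2) != 0 by rewrite -unitfE -unitmxE; exact: GLvalP.
have [duv|duv] := eqVneq (det2 u v) 0.
  by rewrite !st_sym_degenerate ?raddf0 // det2_mulmx duv mulr0.
have [A eA ->] := st_sym_GL duv.
by rewrite Steinberg_actE st_symE /= eA mulmx_cols col_cols0 col_cols1.
Qed.

Lemma Steinberg_ind (P : Steinberg F 2 -> Prop) :
  P 0 -> (forall A, P (Steinberg_sym A)) -> (forall x x', P x -> P x' -> P (x - x')) ->
  forall x, P x.
Proof.
move=> P0 Pgen PB x; rewrite -(zreprK x); elim/freeab_ind: (zrepr x) => [|A|a c Pa Pc].
- by rewrite raddf0.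
- exact: Pgen.
- by rewrite raddfB; exact: PB.
Qed.

Lemma GL_col_neq0 A : col 0 (A : 'M_2) != 0 /\ col 1 (A : 'M_2) != 0.
Proof. by apply: det2_neq0; rewrite -det_cols cols_col -unitfE -unitmxE GLvalP. Qed.

(** A function on lines extends to the Steinberg module by sending [u, v] to the
difference of its values at the two lines. *)
Section Difference.
Variable W : zmodType.
Implicit Types h : 'cV[F]_2 -> W.

Definition homogeneous h := forall k v, k != 0 -> h (k *: v) = h v.

Definition st_diff h : {additive freeab (GL F 2) -> W} :=
  freeab_lift (fun A => h (col 0 (A : 'M_2)) - h (col 1 (A : 'M_2))).

Definition st_lift h (x : Steinberg F 2) : W := st_diff h (zrepr x).

Lemma st_diffE h A : st_diff h (fgen A) = h (col 0 (A : 'M_2)) - h (col 1 (A : 'M_2)).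
Proof. exact: freeab_liftE. Qed.

Lemma st_diff_rel h : homogeneous h -> forall x, Steinberg_rel x -> st_diff h x = 0.
Proof.
have exA A : exists u v, A = cols u v :> 'M_2.
  by exists (col 0 (A : 'M_2)), (col 1 (A : 'M_2)); rewrite cols_col.
move=> hh x; case=> [A B C i j l l0 ij eB eC|A B i l l0 eB|A B s eB]; have [u [v eA]] := exA A.
- have [i0 j1] : i = 0 /\ j = 1.
    case: i ij {eB eC} => [[|[|?]] ?]; case: j => [[|[|?]] ?] //= _.
    by split; apply: val_inj.
  rewrite raddfB raddfD !st_diffE eB eC eA i0 j1 set_col0 set_col1 !col_cols0 !col_cols1.
  set a := h _; set c := h _; set d := h _.
  by rewrite [d - c + _]addrC addrA subrK subrr.
- rewrite raddfB !st_diffE eB eA; have [->|] := eqVneq i 0.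
    by rewrite set_col0 !col_cols0 !col_cols1 hh // subrr.
  by rewrite -ord2_eq1 => /eqP ->; rewrite set_col1 !col_cols0 !col_cols1 hh // subrr.
- rewrite raddfB raddfMz !st_diffE eB eA !col_cols0 !col_cols1.
  have colE k : col k (col_perm s (cols u v)) = if s k == 0 then u else v.
    by apply/colP => r; rewrite !mxE; case: (s k == 0).
  rewrite !colE; have := perm2E s; case: ifP => _ ->.
    by rewrite odd_perm1 expr0 !perm1 /= subrr.
  by rewrite odd_tperm tpermR expr1 /= mulrN1z opprB subrr.
Qed.

Lemma st_liftE h A : homogeneous h ->
  st_lift h (Steinberg_sym A) = h (col 0 (A : 'M_2)) - h (col 1 (A : 'M_2)).
Proof.
move=> hh; have fB : zmod_morphism (st_diff h) by move=> x x'; exact: raddfB.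
by rewrite /st_lift (zlift_proj fB (st_diff_rel hh)) st_diffE.
Qed.

Lemma st_liftB h : homogeneous h -> zmod_morphism (st_lift h).
Proof.
move=> hh; have fB : zmod_morphism (st_diff h) by move=> x x'; exact: raddfB.
exact: zlift_zmod_morphism fB (st_diff_rel hh).
Qed.

Lemma st_lift_fctB h h' x : st_lift (fun v => h v - h' v) x = st_lift h x - st_lift h' x.
Proof.
rewrite /st_lift; elim/freeab_ind: (zrepr x) => [|A|a c ea ec].
- by rewrite !(raddf0 (st_diff _)) subrr.
- by rewrite !st_diffE !opprD !opprK addrACA.
- by rewrite !(raddfB (st_diff _)) ea ec !opprD !opprK addrACA.
Qed.

End Difference.

End SteinbergSymbols.

(** * Tensor products *)

Lemma tensor_lift (A B W : zmodType) (g : A -> B -> W) :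
  (forall b, zmod_morphism (g^~ b)) -> (forall a, zmod_morphism (g a)) ->
  exists f : {additive tensor A B -> W}, forall a b, f (tens a b) = g a b.
Proof.
move=> gl gr; pose G p := g p.1 p.2.
have morphD (V V' : zmodType) (h : V -> V') : zmod_morphism h -> {morph h : x x' / x + x'}.
  move=> hB x x'; have h0 : h 0 = 0 by rewrite -(subrr 0) hB subrr.
  have hN z : h (- z) = - h z by rewrite -sub0r hB h0 sub0r.
  by rewrite -{1}[x']opprK hB hN opprK.
have [x|f fE] := @zquot_lift _ _ (@tensor_rel A B) (freeab_lift G).
  case=> [a a' b|a b b']; rewrite /= freeab_liftB freeab_liftD !freeab_liftE /G /=.
    by rewrite (morphD _ _ _ (gl b)) subrr.
  by rewrite (morphD _ _ _ (gr a)) subrr.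
by exists f => a b; rewrite /tens fE /= freeab_liftE.
Qed.

Lemma tensor_ind (A B : zmodType) (P : tensor A B -> Prop) :
  P 0 -> (forall a b, P (tens a b)) -> (forall x x', P x -> P x' -> P (x - x')) ->
  forall x, P x.
Proof.
move=> P0 Pgen PB x; rewrite -(zreprK x); elim/freeab_ind: (zrepr x) => [|[a b]|a c Pa Pc].
- by rewrite raddf0.
- exact: Pgen.
- by rewrite raddfB; exact: PB.
Qed.

Section TensorArithmetic.
Variables (A B : zmodType).
Implicit Types (a : A) (b : B).

Lemma tensBl a a' b : tens (a - a') b = tens a b - tens a' b.
Proof. by apply/(addIr (tens a' b)); rewrite -tensDl !subrK. Qed.
Lemma tensBr a b b' : tens a (b - b') = tens a b - tens a b'.
Proof. by apply/(addIr (tens a b')); rewrite -tensDr !subrK. Qed.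
Lemma tens0l b : tens (0 : A) b = 0.
Proof. by rewrite -(subrr 0) tensBl subrr. Qed.
Lemma tens0r a : tens a (0 : B) = 0.
Proof. by rewrite -(subrr 0) tensBr subrr. Qed.
Lemma tensNl a b : tens (- a) b = - tens a b.
Proof. by rewrite -sub0r tensBl tens0l sub0r. Qed.
Lemma tensNr a b : tens a (- b) = - tens a b.
Proof. by rewrite -sub0r tensBr tens0r sub0r. Qed.
End TensorArithmetic.

(** * Generators and relations in the coinvariants *)

Section Coinvariants.
Variable F : fieldType.
Implicit Types (u v w z : 'cV[F]_2).

Definition double_Steinberg : zmodType := tensor (Steinberg F 2) (Steinberg F 2).

Definition SL_coinv : zmodType :=
  coinvariants (fun M : SL F 2 => Steinberg2_act (sval M) : double_Steinberg -> double_Steinberg).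

Definition coinv_proj : {additive double_Steinberg -> SL_coinv} := zproj _.

Definition sym2 u v w z : SL_coinv := coinv_proj (tens (st_sym u v) (st_sym w z)).

Lemma sym2_SL (M : 'M[F]_2) u v w z : \det M = 1 ->
  sym2 (M *m u) (M *m v) (M *m w) (M *m z) = sym2 u v w z.
Proof.
move=> detM; have unitM : M \in unitmx by rewrite unitmxE detM unitr1.
have detM' : \det (MkGL unitM) == 1 by rewrite detM.
apply/zproj_eq/zgen_rel; exists (exist _ (MkGL unitM) detM'), (tens (st_sym u v) (st_sym w z)).
by rewrite /= /Steinberg2_act tensor_mapE /= !Steinberg_act_st.
Qed.

Lemma SL_coinv_ext (W : zmodType) (f g : {additive SL_coinv -> W}) :
  (forall u v w z, u != 0 -> v != 0 -> w != 0 -> z != 0 -> f (sym2 u v w z) = g (sym2 u v w z)) ->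
  f =1 g.
Proof.
move=> fg; apply: zquot_ext; elim/tensor_ind=> [|s t|x x' ex ex'].
- by rewrite !raddf0.
- elim/Steinberg_ind: s t => [t|A|s s' es es' t].
  + by rewrite tens0l !raddf0.
  + elim/Steinberg_ind=> [|B|t t' et et'].
    * by rewrite tens0r !raddf0.
    * by rewrite !st_symE; have [? ?] := GL_col_neq0 A; have [? ?] := GL_col_neq0 B; apply: fg.
    * by rewrite tensBr !raddfB et et'.
  + by rewrite tensBl !raddfB es es'.
- by rewrite !raddfB ex ex'.
Qed.

Lemma sym2_cocycler u v w x z : w != 0 -> x != 0 -> z != 0 ->
  sym2 u v w z = sym2 u v w x + sym2 u v x z.
Proof. by move=> *; rewrite /sym2 (@st_sym_cocycle _ w x z) // tensDr raddfD. Qed.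
Lemma sym2_cocyclel u v w x z : u != 0 -> x != 0 -> v != 0 ->
  sym2 u v w z = sym2 u x w z + sym2 x v w z.
Proof. by move=> *; rewrite /sym2 (@st_sym_cocycle _ u x v) // tensDl raddfD. Qed.
Lemma sym2Cl u v w z : sym2 u v w z = - sym2 v u w z.
Proof. by rewrite /sym2 (st_symC u v) tensNl raddfN. Qed.
Lemma sym2Cr u v w z : sym2 u v w z = - sym2 u v z w.
Proof. by rewrite /sym2 (st_symC w z) tensNr raddfN. Qed.
Lemma sym20l u v w z : det2 u v = 0 -> sym2 u v w z = 0.
Proof. by move=> uv; rewrite /sym2 (st_sym_degenerate uv) tens0l raddf0. Qed.
Lemma sym20r u v w z : det2 w z = 0 -> sym2 u v w z = 0.
Proof. by move=> wz; rewrite /sym2 (st_sym_degenerate wz) tens0r raddf0. Qed.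

(** For [u], [v], [w] the vectors (1,0), (a,1), (0,1), the product
[det2 u v * det2 u w * det2 v w] is [a]. *)
Definition coinv_gw (a : F) : SL_coinv := sym2 (vec2 1 0) (vec2 a 1) (vec2 1 0) (vec2 0 1).

(** A matrix of determinant 1 takes the three lines to those of [coinv_gw]. *)
Lemma sym2_corner u v w : det2 u v != 0 -> det2 u w != 0 -> det2 v w != 0 ->
  sym2 u v u w = coinv_gw (det2 u v * det2 u w * det2 v w).
Proof.
move=> uv uw vw; pose k := det2 u v; pose c := k * det2 u w.
have k0 : k != 0 by []; have c0 : c != 0 by rewrite mulf_neq0.
(* [M x] is the vector with coordinates [k * det2 x w] and [det2 u x / c]. *)
pose M := cols (vec2 (k * w 1 0) (- (u 1 0 / c))) (vec2 (- (k * w 0 0)) (u 0 0 / c)).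
have Mx x : M *m x = vec2 (k * det2 x w) (det2 u x / c).
  by rewrite mulmx_colsl; apply: vec2P; rewrite !mxE /= /det2; ring.
have detM : \det M = 1.
  rewrite det_cols det2_vec2; transitivity (k * det2 u w / c); first by rewrite /det2; ring.
  exact: mulfV.
rewrite -(sym2_SL _ _ _ _ detM) !Mx !det2vv mulr0 mul0r.
have -> : vec2 (k * det2 u w) 0 = c *: vec2 1 0 by apply: vec2P; rewrite !mxE /= ?mulr1 ?mulr0.
have -> : vec2 0 (det2 u w / c) = (det2 u w / c) *: vec2 0 1.
  by apply: vec2P; rewrite !mxE /= ?mulr1 ?mulr0.
have -> : vec2 (k * det2 v w) (det2 u v / c) =
    (det2 u v / c) *: vec2 (det2 u v * det2 u w * det2 v w) 1.
  by apply: vec2P; rewrite !mxE /= ?mulr1 // /c /k; field; rewrite uv uw.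
by rewrite /sym2 !(st_symZl, st_symZr) // mulf_neq0 ?invr_eq0.
Qed.

(** Subdivide the second factor at [w]; exchanging [u] and [v] changes the sign
of the product of determinants. *)
Lemma sym2_digon u v w : det2 u v != 0 -> det2 u w != 0 -> det2 v w != 0 ->
  sym2 u v u v = coinv_gw (det2 u v * det2 u w * det2 v w) +
                coinv_gw (- (det2 u v * det2 u w * det2 v w)).
Proof.
move=> uv uw vw; have [[u0 v0] [_ w0]] := (det2_neq0 uv, det2_neq0 uw).
rewrite (@sym2_cocycler _ _ u w v) // sym2_corner //; congr (_ + _).
rewrite sym2Cl sym2Cr opprK sym2_corner //; last by rewrite det2C oppr_eq0.
by rewrite (det2C v u); congr coinv_gw; ring.
Qed.

Lemma vec2_neq0 (s t : F) : (s != 0) || (t != 0) -> vec2 s t != 0.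
Proof.
move=> st0; apply: contraTneq st0 => /matrixP e.
by move: (e 0 0) (e 1 0); rewrite !mxE /= => -> ->; rewrite eqxx.
Qed.

(** The first relation expresses that [u] may be rescaled. The last one is the
equality of the two subdivisions of [[u1, u2] (x) [u3, u4]] for the lines of
affine coordinates [a + c], [c], infinity and 0. *)
Theorem coinv_gw_symbol : gw_symbol coinv_gw.
Proof.
have digon a : a != 0 ->
    coinv_gw a + coinv_gw (- a) = sym2 (vec2 1 0) (vec2 0 1) (vec2 1 0) (vec2 0 1).
  move=> a0; pose w := vec2 (- a) 1; have i1 : (1 : F) != 0 := oner_neq0 F.
  have duv : det2 (vec2 1 0) (vec2 0 1) = 1 :> F by rewrite det2_vec2; ring.
  have duw : det2 (vec2 1 0) w = 1 by rewrite det2_vec2; ring.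
  have dvw : det2 (vec2 0 1) w = a by rewrite det2_vec2; ring.
  by rewrite (@sym2_digon _ _ w) ?duv ?duw ?dvw // !mul1r.
split=> [a c a0 c0|a a0|a c a0 c0 ac0].
- transitivity (sym2 (c *: vec2 1 0) (vec2 a 1) (c *: vec2 1 0) (vec2 0 1)); last first.
    by rewrite /sym2 !st_symZl.
  have d1 : det2 (c *: vec2 1 0) (vec2 a 1) = c by rewrite det2Zl det2_vec2; ring.
  have d2 : det2 (c *: vec2 1 0) (vec2 0 1) = c by rewrite det2Zl det2_vec2; ring.
  have d3 : det2 (vec2 a 1) (vec2 0 1) = a by rewrite det2_vec2; ring.
  by rewrite sym2_corner ?d1 ?d2 ?d3 //; congr coinv_gw; ring.
- by rewrite !digon ?oner_neq0.
- pose u1 := vec2 (a + c) 1; pose u2 := vec2 c 1.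
  pose u3 := vec2 (1 : F) 0; pose u4 := vec2 (0 : F) 1.
  have n1 : u1 != 0 by apply: vec2_neq0; rewrite oner_neq0 orbT.
  have n2 : u2 != 0 by apply: vec2_neq0; rewrite oner_neq0 orbT.
  have n3 : u3 != 0 by apply: vec2_neq0; rewrite oner_neq0.
  have n4 : u4 != 0 by apply: vec2_neq0; rewrite oner_neq0 orbT.
  have e1 := @sym2_cocycler u1 u2 u3 u1 u4 n3 n1 n4.
  have e2 := @sym2_cocyclel u1 u2 u3 u3 u4 n1 n3 n2.
  have d12 : det2 u1 u2 = a by rewrite det2_vec2; ring.
  have d13 : det2 u1 u3 = -1 by rewrite det2_vec2; ring.
  have d23 : det2 u2 u3 = -1 by rewrite det2_vec2; ring.
  have d14 : det2 u1 u4 = a + c by rewrite det2_vec2; ring.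
  have d24 : det2 u2 u4 = c by rewrite det2_vec2; ring.
  have d31 : det2 u3 u1 = 1 by rewrite det2_vec2; ring.
  have d32 : det2 u3 u2 = 1 by rewrite det2_vec2; ring.
  have d34 : det2 u3 u4 = 1 by rewrite det2_vec2; ring.
  have m1 : (-1 : F) != 0 by rewrite oppr_eq0 oner_neq0.
  have i1 : (1 : F) != 0 := oner_neq0 F.
  rewrite e1 (sym2Cr u1 u2) (sym2Cl u1 u3) in e2; move: e2.
  rewrite !sym2_corner ?d12 ?d13 ?d23 ?d14 ?d24 ?d31 ?d32 ?d34 //.
  rewrite !mulrN1 opprK !mulr1 !mul1r => e2.
  rewrite (_ : a * c * (a + c) = a * (a + c) * c); last by ring.
  by apply: (addrI (- coinv_gw (a + c))); rewrite addKr addrCA -e2 addNKr.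
Qed.

End Coinvariants.

(** * The universal property of the coinvariants *)

Section CoinvariantsUniversal.
Variable F : fieldType.
Implicit Types (u v w z : 'cV[F]_2).
Local Notation e := (vec2 (1 : F) 0).

Lemma vec10_neq0 : e != 0.
Proof. by apply: vec2_neq0; rewrite oner_neq0. Qed.

(** Both factors are expanded through [e]; a corner with [v] and [w] on the same
line is subdivided at the auxiliary vector [e + v]. *)
Lemma SL_coinv_gen (W : zmodType) (f g : {additive SL_coinv F -> W}) :
  (forall a, a != 0 -> f (coinv_gw a) = g (coinv_gw a)) -> f =1 g.
Proof.
move=> fg.
have fg_e v w : v != 0 -> w != 0 -> f (sym2 e v e w) = g (sym2 e v e w).
  move=> v0 w0; have [ev|ev] := eqVneq (det2 e v) 0; first by rewrite sym20l ?raddf0.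
  have [ew|ew] := eqVneq (det2 e w) 0; first by rewrite sym20r ?raddf0.
  have [vw|vw] := eqVneq (det2 v w) 0; last by rewrite sym2_corner // fg ?mulf_neq0.
  have [k k0 ->] := det2_eq0 v0 w0 vw; rewrite /sym2 st_symZr // -/(sym2 e v e v).
  have evz : det2 e (e + v) != 0 by rewrite det2Dr det2vv add0r.
  have vvz : det2 v (e + v) != 0 by rewrite det2Dr det2vv addr0 det2C oppr_eq0.
  by rewrite (sym2_digon ev evz vvz) !raddfD !fg ?oppr_eq0 ?mulf_neq0.
have e0 := vec10_neq0; apply: SL_coinv_ext => u v w z u0 v0 w0 z0.
rewrite (@sym2_cocyclel _ u v w e) // (sym2Cl u e) !(@sym2_cocycler _ e _ w e z) // !(sym2Cr e _ w e).
by rewrite !(raddfD, raddfN) !fg_e.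
Qed.

Lemma st_lift_st (W : zmodType) (h : 'cV[F]_2 -> W) u v : homogeneous h -> det2 u v != 0 ->
  st_lift h (st_sym u v) = h u - h v.
Proof. by move=> hh /st_sym_GL [A eA ->]; rewrite st_liftE // eA col_cols0 col_cols1. Qed.

Section Pairing.
Variables (W : zmodType) (y : F -> W).
Hypothesis ysym : gw_symbol y.

Definition pairing (s t : Steinberg F 2) : W :=
  st_lift (fun v => st_lift (corner_value y e v) t) s.

Lemma corner_value_homogeneous v : homogeneous (corner_value y e v).
Proof. by move=> k w k0; rewrite corner_valueZr. Qed.

Lemma st_lift_corner_value_homogeneous t : homogeneous (fun v => st_lift (corner_value y e v) t).
Proof. by move=> k v k0; congr (st_lift _ t); apply/funext => w; rewrite corner_valueZl. Qed.

Lemma pairingBl t : zmod_morphism (pairing^~ t).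
Proof. exact/st_liftB/st_lift_corner_value_homogeneous. Qed.

Lemma pairingBr s : zmod_morphism (pairing s).
Proof.
move=> t t'; rewrite /pairing -st_lift_fctB; congr (st_lift _ s); apply/funext => v.
exact/st_liftB/corner_value_homogeneous.
Qed.

Lemma pairing_st u v w z : det2 u v != 0 -> det2 w z != 0 ->
  pairing (st_sym u v) (st_sym w z) =
    (corner_value y e u w - corner_value y e u z) -
    (corner_value y e v w - corner_value y e v z).
Proof.
move=> uv wz; rewrite /pairing !st_lift_st //; [exact: corner_value_homogeneous..|].
exact: st_lift_corner_value_homogeneous.
Qed.

Lemma corner_value_SL (M : 'M[F]_2) f v w : \det M = 1 ->
  corner_value y (M *m f) (M *m v) (M *m w) = corner_value y f v w.
Proof. by move=> detM; rewrite /corner_value !det2_mulmx detM !mul1r. Qed.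

(** A matrix of determinant 1 transports the base vector [f] to [e], so this is
the independence of the base vector. By [corner_value_base_change] a change of
base adds to the value of a corner functions of [v] alone and of [w] alone, which
cancel in the alternating sum over a pair of symbols. *)
Lemma pairing_SL (M : SL F 2) s t :
  pairing (Steinberg_act (sval M) s) (Steinberg_act (sval M) t) = pairing s t.
Proof.
have pl t' : pairing 0 t' = 0 by rewrite -(subrr 0) pairingBl subrr.
have pr s' : pairing s' 0 = 0 by rewrite -(subrr 0) pairingBr subrr.
elim/Steinberg_ind: s t => [t|A|s s' es es' t]; first by rewrite raddf0 !pl.
  elim/Steinberg_ind=> [|B|t t' et et']; first by rewrite raddf0 !pr.
    rewrite !st_symE; set u := col 0 _; set v := col 1 _; set w := col 0 _; set z := col 1 _.
    have duv : det2 u v != 0 by rewrite -det_cols cols_col -unitfE -unitmxE GLvalP.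
    have dwz : det2 w z != 0 by rewrite -det_cols cols_col -unitfE -unitmxE GLvalP.
    clearbody u v w z; case: M => [[M uM] detM] /=; have {}detM := eqP detM; rewrite /= in detM.
    rewrite !Steinberg_act_st /= !pairing_st ?det2_mulmx ?detM ?mul1r //.
    pose f := invmx M *m e; have ef : e = M *m f by rewrite mulKVmx.
    have f0 : f != 0 by apply: contraNneq vec10_neq0 => f0; rewrite ef f0 mulmx0.
    rewrite {1 2 3 4}ef !corner_value_SL //.
    have [[u0 v0] [w0 z0]] := (det2_neq0 duv, det2_neq0 dwz).
    have shift x p q : x != 0 -> p != 0 -> q != 0 ->
      corner_value y f x p - corner_value y f x q =
      (corner_value y e x p - corner_value y e x q) +
      (corner_value y e f q - corner_value y e f p).
      move=> x0 p0 q0; rewrite !(corner_value_base_change ysym vec10_neq0 f0) //.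
      rewrite -!(addrA _ (- corner_value y e x f)).
      rewrite [X in _ - X]addrC addrKA opprD addrACA opprK.
      by rewrite [- _ + corner_value y e f q]addrC.
    by rewrite !shift // opprD addrACA subrr addr0.
  by rewrite raddfB !pairingBr et et'.
by rewrite raddfB !pairingBl es es'.
Qed.

End Pairing.

Theorem SL_coinv_universal (W : zmodType) (y : F -> W) : gw_symbol y ->
  exists f : {additive SL_coinv F -> W}, forall a, a != 0 -> f (coinv_gw a) = y a.
Proof.
move=> ysym; have [g gE] := tensor_lift (pairingBl ysym) (pairingBr ysym).
have gSL x : (exists (M : SL F 2) t, x = Steinberg2_act (sval M) t - t) -> g x = 0.
  case=> M [t ->]; rewrite /Steinberg2_act raddfB; apply/eqP; rewrite subr_eq0; apply/eqP.
  elim/tensor_ind: t => [|s t|t t' et et']; first by rewrite !raddf0.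
    by rewrite tensor_mapE !gE pairing_SL.
  by rewrite !raddfB et et'.
have [f fE] := zquot_lift gSL; exists f => a a0.
pose v := vec2 a 1; pose w := vec2 (0 : F) 1.
have ev : det2 e v = 1 by rewrite det2_vec2; ring.
have ew : det2 e w = 1 by rewrite det2_vec2; ring.
have vw : det2 v w = a by rewrite det2_vec2; ring.
rewrite /coinv_gw /sym2 fE gE pairing_st ?ev ?ew ?oner_neq0 //.
rewrite /corner_value det2vv eqxx orbT /= ev ew vw oner_eq0 (negPf a0) /=.
by rewrite !subr0 !sub0r opprK !mul1r.
Qed.

End CoinvariantsUniversal.

(** * The isomorphism *)

(** Each group carries the symbol of the other, and the two induced maps are
mutually inverse because they are so on generators. *)
Theorem theoremA (F : fieldType) :
  exists f : {additive
      coinvariants (fun M : SL F 2 =>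
        Steinberg2_act (sval M) :
          tensor (Steinberg F 2) (Steinberg F 2) ->
          tensor (Steinberg F 2) (Steinberg F 2))
      -> GW F},
    bijective f.
Proof.
have [f fE] := SL_coinv_universal (gw_is_symbol F).
have [g gE] := GW_universal (coinv_gw_symbol F).
exists f; exists g.
- apply: (SL_coinv_gen (f := g \o f) (g := idfun)) => a a0.
  exact: etrans (congr1 g (fE a a0)) (gE a a0).
- apply: (GW_ext (f := f \o g) (g := idfun)) => a a0.
  exact: etrans (congr1 f (gE a a0)) (fE a a0).
Qed.
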